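(* Let $K$ be a field and let $G$ be a graph on the vertex set $\{1,\dots,n\}$. Then for every $T\in\mathscr C(G)$, with $G_1,\dots,G_{c_G(T)}$ the connected components of $G\setminus T$, and every $\mathbf v\in V(G_1)\times\cdots\times V(G_{c_G(T)})$, one has $\mathrm{ht}(P_T(\mathbf v))=n+|T|-c_G(T)$. Moreover, $J_G$ is unmixed if and only if $\mathrm{in}_<(J_G)$ is unmixed.
   Context: All graphs are finite and simple. For a graph $G$ with $V(G)=\{1,\dots,n\}$ and a field $K$, the binomial edge ideal is $J_G=\langle x_iy_j-x_jy_i \mid \{i,j\}\in E(G),\ i<j\rangle\subseteq \mathcal S=K[x_1,\dots,x_n,y_1,\dots,y_n]$. Here $<$ is the lexicographic order on $\mathcal S$ induced by $x_1>\cdots>x_n>y_1>\cdots>y_n$, and $\mathrm{in}_<(J_G)$ is the initial ideal. Both $J_G$ and $\mathrm{in}_<(J_G)$ are radical; such an ideal is called unmixed if all its minimal primes have the same height. For $T\subseteq V(G)$, $G\setminus T$ is the induced subgraph on $V(G)\setminus T$ and $c_G(T)$ is its number of connected components. A cut vertex is a vertex whose removal increases the number of connected components. A set $T\subseteq V(G)$ is a cutset of $G$ if each $t\in T$ is a cut vertex of $G\setminus(T\setminus\{t\})$ (in particular $\emptyset$ is a cutset); $\mathscr C(G)$ is the set of all cutsets of $G$. For $T\in\mathscr C(G)$ with $G_1,\dots,G_{c_G(T)}$ the connected components of $G\setminus T$, and $\mathbf v=(v_1,\dots,v_{c_G(T)})\in V(G_1)\times\cdots\times V(G_{c_G(T)})$,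 set $P_T(\mathbf v)=\langle x_i,y_i\mid i\in T\rangle+\sum_{k=1}^{c_G(T)}\langle \{x_i,y_j\mid i,j\in V(G_k),\ i<v_k,\ j>v_k\}\rangle$, i.e. the $k$-th summand is generated by all $x_i$ with $i\in V(G_k)$, $i<v_k$, and all $y_j$ with $j\in V(G_k)$, $j>v_k$. *)

(* Defs.v *)
From HB Require Import structures.
From mathcomp Require Import all_boot all_order all_algebra.
From mathcomp Require Export mpoly.

Set Implicit Arguments.
Unset Strict Implicit.
Unset Printing Implicit Defensive.

Import Order.TTheory GRing.Theory.
Local Open Scope ring_scope.

(* Ideals are Prop-valued predicates: the [idealr] structures of ring_quotient
   are boolean, hence restricted to decidable ideals. Equality of ideals is
   mutual inclusion. *)
Section Ideals.
Variable R : comNzRingType.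
Implicit Types (I P Q A : R -> Prop) (k h : nat).

Definition is_ideal I : Prop :=
  [/\ I 0, forall a b, I a -> I b -> I (a + b) & forall a b, I b -> I (a * b)].

Definition ideal_sub I P : Prop := forall a, I a -> P a.

Definition ideal_gen A : R -> Prop := fun f =>
  exists s : seq (R * R),
    (forall p, p \in s -> A p.2) /\ f = \sum_(p <- s) p.1 * p.2.

Definition is_prime_ideal P : Prop :=
  [/\ is_ideal P, ~ P 1 & forall a b, P (a * b) -> P a \/ P b].

Definition minimal_prime I P : Prop :=
  [/\ is_prime_ideal P, ideal_sub I P &
      forall Q, is_prime_ideal Q -> ideal_sub I Q -> ideal_sub Q P ->
                ideal_sub P Q].

(* Strict chain C 0 < C 1 < ... < C k = P of prime ideals (values of C beyond
   k are irrelevant). *)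
Definition prime_chain P k : Prop :=
  exists C : nat -> R -> Prop,
    [/\ forall i, (i <= k)%N -> is_prime_ideal (C i),
        forall i, (i < k)%N ->
          ideal_sub (C i) (C i.+1) /\ ~ ideal_sub (C i.+1) (C i) &
        ideal_sub (C k) P /\ ideal_sub P (C k)].

Definition prime_height P h : Prop :=
  prime_chain P h /\ forall k, prime_chain P k -> (k <= h)%N.

(* [ideal_height I h]: h is the infimum of the heights of the primes containing
   I. A prime of infinite height has no [prime_height] and does not affect the
   infimum. *)
Definition ideal_height I h : Prop :=
  (exists P, [/\ is_prime_ideal P, ideal_sub I P & prime_height P h]) /\
  (forall P k, is_prime_ideal P -> ideal_sub I P -> prime_height P k ->
     (h <= k)%N).

Definition unmixed I : Prop :=
  exists h, forall P, minimal_prime I P -> prime_height P h.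

End Ideals.

Section InitialIdeal.
Variables (K : fieldType) (m : nat).

(* Pure lexicographic order with 'X_0 > 'X_1 > ...; the canonical order on
   'X_{1..m} in mpoly is graded. *)
Definition lex_le (a b : 'X_{1..m}) : bool :=
  ((a : seqlexi nat) <= (b : seqlexi nat))%O.

Definition is_lex_lead (f : {mpoly K[m]}) (a : 'X_{1..m}) : Prop :=
  a \in msupp f /\ forall b, b \in msupp f -> lex_le b a.

Definition initial_ideal (I : {mpoly K[m]} -> Prop) : {mpoly K[m]} -> Prop :=
  ideal_gen (fun g => exists f a, [/\ I f, is_lex_lead f a & g = 'X_[a]]).

End InitialIdeal.

(* A graph on the vertex set 'I_n is given by its adjacency relation [e];
   induced subgraphs are given by their vertex set [A]. *)
Section Graphs.
Variables (n : nat) (e : rel 'I_n).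
Implicit Types (A T : {set 'I_n}).

Definition induced A : rel 'I_n := [rel i j | [&& i \in A, j \in A & e i j]].

Definition components A : {set {set 'I_n}} :=
  equivalence_partition (connect (induced A)) A.

Definition cut_vertex A (v : 'I_n) : bool :=
  (v \in A) && (#|components A| < #|components (A :\ v)|)%N.

Definition cutset T : bool := [forall t in T, cut_vertex (~: (T :\ t)) t].

Definition ncomp T : nat := #|components (~: T)|.

Definition component T (k : 'I_(ncomp T)) : {set 'I_n} := enum_val k.

End Graphs.

Arguments component {n} e T k.

Section BinomialEdgeIdeals.
Variables (K : fieldType) (n : nat) (e : rel 'I_n).

Definition xvar (i : 'I_n) : {mpoly K[n + n]} := 'X_(lshift n i).
Definition yvar (i : 'I_n) : {mpoly K[n + n]} := 'X_(rshift n i).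

Definition binomial_edge_ideal : {mpoly K[n + n]} -> Prop :=
  ideal_gen (fun f => exists i j : 'I_n,
    [/\ (i < j)%N, e i j & f = xvar i * yvar j - xvar j * yvar i]).

(* The sum of ideals is the ideal generated by all the generators together. *)
Definition PT (T : {set 'I_n}) (v : 'I_(ncomp e T) -> 'I_n) :
    {mpoly K[n + n]} -> Prop :=
  ideal_gen (fun f =>
    [\/ exists2 i, i \in T & f = xvar i \/ f = yvar i,
        exists k i, [/\ i \in component e T k, (i < v k)%N & f = xvar i] |
        exists k j, [/\ j \in component e T k, (v k < j)%N & f = yvar j]]).

End BinomialEdgeIdeals.

Arguments binomial_edge_ideal K {n} e _.
Arguments PT K {n} e T v _.

(* Main.v *)
Require Import Defs.
From mathcomp Require Import all_boot all_order all_algebra.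
From mathcomp Require Import zify ring.
From Stdlib Require Import Classical_Prop.

(** Write x_i, y_i for the variables, T for a set of vertices and v for a choice
    of one vertex in each component of G \ T. Besides the monomial primes P_T(v),
    consider the kernel Q_T of the substitution
      x_i |-> s_i a_c, y_i |-> s_i  (c the component of i),
      x_i, y_i |-> 0 for i in T.
    It is prime, contains J_G, and is the ideal generated by the variables of T
    and by the 2-minors of each component. The theorem follows from comparing
    the two families of primes over all vertex sets T.

    Leading monomials. The leading monomial of an element of Q_T lies in every
    P_T(v): the coefficients of the element sum to zero over each fiber of the
    substitution, and a monomial outside P_T(v) is the lex-smallest monomial of
    its fiber ([fiber_lex_min], [toric_lead]).

    Reduction modulo J_G. Let T be the set of vertices that do not occur in a
    monomial a. If i < j lie in the same component of G \ T and x_i y_j divides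
    a, then a path from i to j allows x_i y_j to be replaced by x_j y_i in a
    modulo J_G ([swap_mod]), and the result is lex-smaller. If there is no such
    pair, then a lies outside P_T(v) for a suitable v ([pivot_exists]). So every
    polynomial is congruent modulo J_G to a combination of monomials each of
    which avoids some P_T(v). With the first point this gives
      J_G = intersection of the Q_T,  in(J_G) = intersection of the P_T(v),
    and, more precisely, J_G is the intersection of any subfamily of the Q_T
    whose P_T(v) still have intersection in(J_G) ([toric_cap_sub]).

    Heights. Both Q_T and P_T(v) have height n + |T| - c(T). Chains of that
    length are obtained by killing variables one at a time and, for Q_T, by then
    merging vertices into components one at a time. The upper bound is a
    dimension count: a strict inclusion of primes C < C' gives one more
    polynomial that is algebraically independent modulo C, and there are at most
    as many independent polynomials as variables ([prime_chain_le]).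

    Unmixedness. An intersection of finitely many primes is unmixed exactly when
    its inclusion-minimal members have the same height ([unmixed_cap]), so the
    heights of the minimal Q_T must be compared with those of the minimal P_T(v).
    If P_T(v) is minimal and Q_T' is a minimal member below Q_T, then some
    P_T'(v') is contained in P_T(v), hence equal to it, and the heights agree.
    If Q_T is minimal, then some P_T(v) contains no P_T'(v') with T' <> T:
    otherwise the P_T'(v') with T' <> T would already intersect in in(J_G), J_G
    would be the intersection of the Q_T' with T' <> T, and the prime Q_T would
    contain one of them. A minimal P_T'(v') below this P_T(v) has T' = T, and its
    height is that of Q_T. *)

Set Implicit Arguments.
Unset Strict Implicit.
Unset Printing Implicit Defensive.

Import Order.TTheory GRing.Theory.

(** * Ideals, chains of primes and unmixedness *)

Section IdealTheory.
Local Open Scope ring_scope.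
Variable R : comNzRingType.
Implicit Types (I P Q A : R -> Prop) (k h : nat).

Lemma ideal_sum I (T : eqType) (s : seq T) (F : T -> R) :
  is_ideal I -> (forall i, i \in s -> I (F i)) -> I (\sum_(i <- s) F i).
Proof.
move=> [I0 ID _]; elim: s => [|i s IHs] sI; first by rewrite big_nil.
rewrite big_cons; apply: ID; first by apply: sI; rewrite mem_head.
by apply: IHs => j sj; apply: sI; rewrite in_cons sj orbT.
Qed.

Lemma idealN I a : is_ideal I -> I a -> I (- a).
Proof. by move=> [_ _ IM] Ia; rewrite -mulN1r; apply: IM. Qed.

Lemma idealB I a b : is_ideal I -> I a -> I b -> I (a - b).
Proof.
by move=> idI Ia Ib; have [_ ID _] := idI; apply: ID => //; apply: idealN.
Qed.

Lemma ideal_gen_ideal A : is_ideal (ideal_gen A).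
Proof.
split.
- by exists [::]; split=> //; rewrite big_nil.
- move=> _ _ [s [sA ->]] [t [tA ->]]; exists (s ++ t).
  split; last by rewrite big_cat.
  by move=> p; rewrite mem_cat => /orP[ps|pt]; [apply: sA | apply: tA].
move=> a _ [s [sA ->]]; exists [seq (a * p.1, p.2) | p <- s]; split.
  by move=> _ /mapP[p /sA Ap ->].
by rewrite big_map mulr_sumr; apply: eq_bigr => p _; rewrite mulrA.
Qed.

Lemma ideal_gen_mem A a : A a -> ideal_gen A a.
Proof.
move=> Aa; exists [:: (1, a)]; split; first by move=> p; rewrite inE => /eqP->.
by rewrite big_seq1 mul1r.
Qed.

Lemma ideal_gen_min A I :
  is_ideal I -> (forall a, A a -> I a) -> ideal_sub (ideal_gen A) I.
Proof.
move=> idI AI _ [s [sA ->]]; apply: ideal_sum => // p /sA/AI Ip.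
by case: idI => _ _; apply.
Qed.

Lemma prime_chain0 P : is_prime_ideal P -> prime_chain P 0.
Proof. by move=> prP; exists (fun=> P); split=> //; split. Qed.

Lemma prime_chain_lift P Q k :
  prime_chain P k -> is_prime_ideal Q -> ideal_sub P Q -> prime_chain Q k.
Proof.
move=> [C [Cpr Clt [CP PC]]] prQ PQ.
exists (fun i => if (i < k)%N then C i else Q).
split; last by rewrite ltnn; split.
  by move=> i le_ik; case: ifP => // _; apply: Cpr.
move=> i lt_ik; rewrite lt_ik; have [CS nCS] := Clt i lt_ik.
have [_|ge_ik] := ltnP; first by [].
have Ek : i.+1 = k by apply/eqP; rewrite eqn_leq lt_ik.
rewrite Ek in CS nCS; split; first by move=> a /CS/CP/PQ.
by move=> QC; apply: nCS => a /CP/PQ/QC.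
Qed.

Lemma prime_chain_step P Q k :
  prime_chain P k -> is_prime_ideal Q -> ideal_sub P Q -> ~ ideal_sub Q P ->
  prime_chain Q k.+1.
Proof.
move=> [C [Cpr Clt [CP PC]]] prQ PQ nQP.
exists (fun i => if (i <= k)%N then C i else Q).
split; last by rewrite ltnn; split.
  by move=> i _; case: ifP => // /Cpr.
move=> i; rewrite ltnS => le_ik; rewrite le_ik.
have [lt_ik|ge_ik] := ltnP; first exact: Clt.
have -> : i = k by apply/eqP; rewrite eqn_leq le_ik.
by split=> [a /CP/PQ //|QC]; apply: nQP => a /QC/CP.
Qed.

Lemma prime_height_eq P Q h :
  ideal_sub P Q -> ideal_sub Q P -> prime_height P h -> prime_height Q h.
Proof.
move=> PQ QP [[C [Cpr Clt [CP PC]]] maxh]; split.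
  by exists C; split=> //; split=> a; [move/CP/PQ | move/QP/PC].
move=> k [D [Dpr Dlt [DQ QD]]]; apply: maxh; exists D; split=> //.
by split=> a; [move/DQ/QP | move/PQ/QD].
Qed.

Lemma prime_height_uniq P h k : prime_height P h -> prime_height P k -> h = k.
Proof.
by move=> [ch maxh] [ck maxk]; apply/eqP; rewrite eqn_leq maxh // maxk.
Qed.

(** Prime avoidance in product form: if no member were contained in P, the
    product of elements witnessing this would lie in every member but not in the
    prime P. *)
Lemma prime_contains_cap (T : eqType) (s : seq T) (Q : T -> R -> Prop) P :
  is_prime_ideal P -> (forall a, a \in s -> is_ideal (Q a)) ->
  (forall f, (forall a, a \in s -> Q a f) -> P f) ->
  exists2 a, a \in s & ideal_sub (Q a) P.
Proof.
move=> [idP P1 Ppr]; suff avoid: (forall a, a \in s -> is_ideal (Q a)) ->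
    (forall a, a \in s -> ~ ideal_sub (Q a) P) ->
    exists2 f, (forall a, a \in s -> Q a f) & ~ P f.
  move=> idQ capP; apply: NNPP => noa; have [//|a sa QaP|f Qf nPf] := avoid.
    by apply: noa; exists a.
  exact: nPf (capP f Qf).
elim: s => [|a s IHs] idQ nQP; first by exists 1.
have [b sb|b sb|f Qf nPf] := IHs.
- by apply: idQ; rewrite inE sb orbT.
- by apply: nQP; rewrite inE sb orbT.
have [g Qg nPg] : exists2 g, Q a g & ~ P g.
  apply: NNPP => nog; apply: (nQP a); rewrite ?mem_head // => g Qg.
  by apply: NNPP => nPg; apply: nog; exists g.
exists (f * g); last by move/Ppr=> [].
move=> b; rewrite inE => /predU1P[->|sb].
  by have [_ _ QM] := idQ _ (mem_head a s); apply: QM.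
have idQb : is_ideal (Q b) by apply: idQ; rewrite inE sb orbT.
by rewrite mulrC; have [_ _ QM] := idQb; apply: QM; apply: Qf.
Qed.

(** By [prime_contains_cap] the minimal primes of such an intersection are
    precisely its inclusion-minimal members. *)
Lemma unmixed_cap (T : finType) (D : pred T) (Q : T -> R -> Prop)
    (h : T -> nat) I :
  (forall a, D a -> is_prime_ideal (Q a)) ->
  (forall a, D a -> prime_height (Q a) (h a)) ->
  (forall f, I f <-> forall a, D a -> Q a f) ->
  unmixed I <->
  exists d, forall a, D a ->
    (forall c, D c -> ideal_sub (Q c) (Q a) -> ideal_sub (Q a) (Q c)) ->
    h a = d.
Proof.
move=> Qpr Qht IQ.
have subQ a : D a -> ideal_sub I (Q a) by move=> Da f /IQ; apply.
have supQ P : is_prime_ideal P -> ideal_sub I P ->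
    exists2 a, D a & ideal_sub (Q a) P.
  move=> prP IP; have [//|a|f Qf|a] := @prime_contains_cap T (enum D) Q P.
  - by rewrite mem_enum => /Qpr[].
  - by apply/IP/IQ => a Da; apply: Qf; rewrite mem_enum.
  by rewrite mem_enum; exists a.
split=> -[d Hd]; exists d.
  move=> a Da mina; apply: (@prime_height_uniq (Q a)); first exact: Qht.
  apply: Hd; split; [exact: Qpr | exact: subQ |] => P prP IP PQ.
  have [c Dc QcP] := supQ P prP IP.
  by move=> f /(mina c Dc) Qf; apply/QcP/Qf => g /QcP/PQ.
move=> P [prP IP minP]; have [c Dc QcP] := supQ P prP IP.
have PQc := minP _ (Qpr c Dc) (subQ c Dc) QcP.
apply: (prime_height_eq QcP PQc); rewrite -(Hd c Dc); first exact: Qht.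
move=> b Db QbQc f /QcP; apply: minP; [exact: Qpr|exact: subQ|] => g Qg.
exact/QcP/QbQc.
Qed.

End IdealTheory.

(** The comparison is Prop-valued, as it will be inclusion of ideals; an
    induction on the enumeration replaces the choice of a minimum. *)
Lemma finite_minimal (T : finType) (le : T -> T -> Prop) (D : pred T) (a : T) :
  (forall x, le x x) -> (forall y x z, le x y -> le y z -> le x z) -> D a ->
  exists b, [/\ D b, le b a & forall c, D c -> le c b -> le b c].
Proof.
move=> le_refl le_trans Da.
suff [b Db [leba minb]] : exists2 b, D b &
    le b a /\ forall c, c \in enum D -> le c b -> le b c.
  by exists b; split=> // c Dc; apply: minb; rewrite mem_enum.
have: {subset enum D <= D} by move=> x; rewrite mem_enum.
elim: (enum D) a Da => [|x s IHs] a Da sD; first by exists a.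
have sD' : {subset s <= D} by move=> y sy; apply: sD; rewrite inE sy orbT.
have [b Db [leba minb]] := IHs a Da sD'.
case: (classic (le x b)) => [lexb|nlexb]; last first.
  by exists b => //; split=> // c; rewrite inE => /predU1P[->|/minb].
have [b' Db' [leb'x minb']] := IHs x (sD x (mem_head x s)) sD'.
exists b' => //; split; first exact: le_trans (le_trans _ _ _ leb'x lexb) leba.
by move=> c; rewrite inE => /predU1P[->|/minb'].
Qed.

(** * The lexicographic order *)

Section Lex.
Implicit Types (s t : seq nat).

Lemma lexi_first_diff s t : size s = size t ->
  ((s : seqlexi nat) <= t)%O -> s <> t ->
  exists i, [/\ i < size s, nth 0 s i < nth 0 t i &
    forall j, j < i -> nth 0 s j = nth 0 t j].
Proof.
elim: s t => [|x s IHs] [|y t] //= [sz]; rewrite lexi_cons leEnat.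
case: ltngtP => //= [lt_xy _ _|-> le_st ne]; first by exists 0.
have [|i [lt_is lt_i eq_i]] := IHs t sz le_st.
  by move=> E; case: ne; rewrite E.
by exists i.+1; split=> // -[|j] //; apply: eq_i.
Qed.

Lemma lexi_of_diff s t i : nth 0 s i < nth 0 t i -> i < size s ->
  (forall j, j < i -> nth 0 s j = nth 0 t j) -> ((s : seqlexi nat) <= t)%O.
Proof.
elim: i s t => [|i IHi] [|x s] [|y t] //= lt_i lt_is eq_i;
  rewrite lexi_cons leEnat.
  by rewrite ltnW //= leqNgt lt_i.
have /= -> := eq_i 0 isT; rewrite leqnn /=; apply: IHi => // j lt_ji.
exact: (eq_i j.+1).
Qed.

Variable m : nat.
Implicit Types a b : 'X_{1..m}.

Lemma lex_first_diff a b : lex_le b a -> b <> a ->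
  exists i, b i < a i /\ forall j : 'I_m, j < i -> b j = a j.
Proof.
move=> le_ba ne_ba; have [||i [lt_im lt_i eq_i]] := lexi_first_diff _ le_ba.
- by rewrite !size_tuple.
- by move=> E; apply/ne_ba/val_inj/val_inj.
rewrite size_tuple in lt_im; exists (Ordinal lt_im).
rewrite !(mnm_nth 0); split=> // j lt_ji.
by rewrite !(mnm_nth 0); apply: eq_i.
Qed.

Lemma lex_of_diff a b (i : 'I_m) : b i < a i ->
  (forall j : 'I_m, j < i -> b j = a j) -> lex_le b a.
Proof.
rewrite !(mnm_nth 0) => lt_i eq_i; apply: (lexi_of_diff lt_i).
  by rewrite size_tuple.
move=> j lt_ji; have := eq_i (Ordinal (ltn_trans lt_ji (ltn_ord i))) lt_ji.
by rewrite !(mnm_nth 0).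
Qed.

Lemma lex_lead_exists (K : fieldType) (f : {mpoly K[m]}) :
  f <> 0%R -> exists a, is_lex_lead f a.
Proof.
move=> nz_f; suff [a sa maxa] : exists2 a, a \in msupp f &
    forall b, b \in msupp f -> lex_le b a by exists a; split.
have: msupp f != [::] by rewrite msupp_eq0; apply/eqP.
elim: (msupp f) => // a [_ _|b s IHs _].
  by exists a => [|b]; rewrite inE // => /eqP->; apply: lexx.
have [c sc maxc] := IHs isT.
have /orP[le_ac|le_ca] := le_total (a : seqlexi nat) (c : seqlexi nat).
  exists c; first by rewrite in_cons sc orbT.
  by move=> d; rewrite in_cons => /predU1P[->|/maxc].
exists a; first exact: mem_head.
move=> d; rewrite in_cons => /predU1P[->|/maxc le_dc]; first exact: lexx.
exact: le_trans le_dc le_ca.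
Qed.

End Lex.

(** * Monomial substitutions and their kernels *)

Section MonomialMaps.
Local Open Scope ring_scope.
Variables (K : fieldType) (m : nat).
Implicit Types (f g : {mpoly K[m]}) (a b : 'X_{1..m}) (Z : {set 'I_m}).

Definition hits Z a : bool := [exists i in Z, (0 < a i)%N].

Lemma hitsPn Z a : reflect (forall i, i \in Z -> a i = 0%N) (~~ hits Z a).
Proof.
apply: (iffP existsPn) => [nZ i Zi|Z0 i].
  by have := nZ i; rewrite Zi /= lt0n negbK => /eqP.
by apply/negP => /andP[/Z0->].
Qed.

Section Maps.
Variables (N : nat) (Z : {set 'I_m}) (u : 'I_m -> 'X_{1..N}).

Definition monmap a : 'X_{1..N} := (\sum_(i < m) u i *+ a i)%MM.

(** One notion covers the two families of primes: variables in [Z] are killed,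
    the others are sent to monomials. With [u] the identity the kernel is the
    ideal generated by the variables in [Z]. *)
Definition monsub f : {mpoly K[N]} :=
  f \mPo [tuple (i \notin Z)%:R *: 'X_[u i] | i < m].

Definition monker f : Prop := monsub f = 0.

Lemma monsubX a : monsub 'X_[a] = (~~ hits Z a)%:R *: 'X_[monmap a].
Proof.
rewrite /monsub comp_mpolyX.
under eq_bigr do rewrite tnth_mktuple exprZn.
rewrite scaler_prod mprodXnE; congr (_ *: _).
have [/existsP[i /andP[Zi ai]]|/hitsPn nZ] := boolP (hits Z a).
  by rewrite (bigD1 i) //= Zi expr0n eqn0Ngt ai mul0r.
apply: big1 => i _; have [Zi|//] := boolP (i \in Z); last by rewrite expr1n.
by rewrite nZ.
Qed.

Lemma mcoeff_monsub f c :
  (monsub f)@_c =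
    \sum_(a <- msupp f | ~~ hits Z a && (monmap a == c)) f@_a.
Proof.
rewrite /monsub comp_mpolyEX raddf_sum /= [RHS]big_mkcond /=.
apply: eq_bigr => a _; rewrite mcoeffZ -/(monsub _) monsubX mcoeffZ mcoeffX.
by rewrite -natrM mulnb; case: ifP; rewrite ?mulr1 ?mulr0.
Qed.

Lemma monker_prime : is_prime_ideal monker.
Proof.
rewrite /monker /monsub; split.
- split; first exact: raddf0.
    by move=> f g f0 g0; rewrite raddfD /= f0 g0 addr0.
  by move=> f g g0; rewrite rmorphM /= g0 mulr0.
- by rewrite rmorph1; apply/eqP/oner_neq0.
move=> f g; rewrite rmorphM /= => /eqP; rewrite mulf_eq0.
by case/orP=> /eqP; [left|right].
Qed.

End Maps.

Definition var_ideal Z : {mpoly K[m]} -> Prop := monker Z (fun i => U_(i)%MM).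

Lemma var_idealP Z f : var_ideal Z f <-> forall a, a \in msupp f -> hits Z a.
Proof.
have coefE c : (monsub Z (fun i => U_(i)%MM) f)@_c = (~~ hits Z c)%:R * f@_c.
  rewrite mcoeff_monsub (eq_bigl (fun a => (a == c) && ~~ hits Z c)); last first.
    move=> a; rewrite /monmap -multinomUE_id andbC.
    by have [->|] := eqVneq a c.
  have [_|] := boolP (hits Z c) => /=.
    by rewrite mul0r big_pred0 // => a; rewrite andbF.
  under eq_bigl do rewrite andbT.
  have [sc|/[dup] nsc /memN_msupp_eq0->] := boolP (c \in msupp f).
    by rewrite -big_filter filter_pred1_uniq ?msupp_uniq // big_seq1 mul1r.
  rewrite mulr0 big_seq_cond big_pred0 // => a.
  by have [->|] := eqVneq a c; rewrite ?(negPf nsc) ?andbF.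
split=> [f0 a|hZ].
  rewrite mcoeff_msupp -[hits Z a]negbK; apply: contra => nZ.
  by have := coefE a; rewrite [monsub _ _ _]f0 mcoeff0 nZ mul1r => <-.
apply/mpolyP => c; rewrite coefE mcoeff0.
have [_|nZ] := boolP (hits Z c); first by rewrite mul0r.
by rewrite memN_msupp_eq0 ?mulr0 //; apply: contra nZ => /hZ.
Qed.

Lemma var_ideal_prime Z : is_prime_ideal (var_ideal Z).
Proof. exact: monker_prime. Qed.

Lemma hitsS Z Z' a : Z \subset Z' -> hits Z a -> hits Z' a.
Proof.
move=> /subsetP ZZ' /existsP[i /andP[Zi ai]].
by apply/existsP; exists i; rewrite ZZ'.
Qed.

Lemma hitsU Z i : hits Z U_(i)%MM = (i \in Z).
Proof.
apply/existsP/idP => [[j /andP[Zj]]|Zi]; last by exists i; rewrite Zi mnm1E eqxx.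
by rewrite mnm1E; have [->|] := eqVneq i j.
Qed.

Lemma var_idealXU Z i : var_ideal Z 'X_i <-> i \in Z.
Proof.
rewrite -hitsU; split=> [/var_idealP-> //|hZ]; first by rewrite msuppX mem_head.
by apply/var_idealP => a; rewrite msuppX inE => /eqP->.
Qed.

Lemma var_idealS Z Z' : ideal_sub (var_ideal Z) (var_ideal Z') <-> Z \subset Z'.
Proof.
split=> [sZ|sZ f /var_idealP hZ]; last first.
  by apply/var_idealP => a /hZ; apply: hitsS.
by apply/subsetP => i /var_idealXU/sZ/var_idealXU.
Qed.

Lemma var_ideal_chain Z : prime_chain (var_ideal Z) #|Z|.
Proof.
have [k leZk] := ubnP #|Z|; elim: k => // k IHk in Z leZk *.
have [->|[i Zi]] := set_0Vmem Z.
  by rewrite cards0; apply/prime_chain0/var_ideal_prime.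
rewrite (cardsD1 i) Zi add1n; apply: (@prime_chain_step _ (var_ideal (Z :\ i))).
- by apply: IHk; move: leZk; rewrite (cardsD1 i) Zi.
- exact: var_ideal_prime.
- by apply/var_idealS; apply: subsetDl.
by move/var_idealS/subsetP/(_ i Zi); rewrite !inE eqxx.
Qed.

Lemma mpoly_sum_termE f : f = \sum_(a <- msupp f) (f@_a)%:MP * 'X_[a].
Proof. by rewrite {1}[f]mpolyE; apply: eq_bigr => a _; rewrite mul_mpolyC. Qed.

End MonomialMaps.

(** * Bounding heights by counting *)

Section Heights.
Local Open Scope ring_scope.
Variables (K : fieldType) (m : nat).
Local Notation S := {mpoly K[m]}.
Implicit Types (P C I : S -> Prop) (f g : S).

Definition lin_indep_mod P (T : finType) (F : T -> S) : Prop :=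
  forall c : T -> K, P (\sum_i c i *: F i) -> forall i, c i = 0.

(** A substitute for transcendence degree: modulo [P] there are, for every N,
    N ^ k linearly independent polynomials of degree linear in N. This is what k
    algebraically independent polynomials provide, through their monomials with
    exponents below N. *)
Definition has_growth P k : Prop :=
  exists D, forall N, (0 < N)%N -> exists (T : finType) (F : T -> S),
    [/\ #|T| = (N ^ k)%N, forall i, (msize (F i) <= D * N)%N &
        lin_indep_mod P F].

Lemma msizeMX f g j : (msize (f * g ^+ j) <= msize f + j * msize g)%N.
Proof.
elim: j => [|j IHj]; first by rewrite expr0 mulr1 addn0.
rewrite exprSr mulrA; set h := f * _ in IHj *.
have [->|nz_h] := eqVneq h 0; first by rewrite mul0r msize0.
have [->|nz_g] := eqVneq g 0; first by rewrite mulr0 msize0.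
rewrite msizeM // (leq_trans (leq_pred _)) // mulSn addnCA addnC leq_add2l.
exact: IHj.
Qed.

(** Multiply the independent family by the powers f^0, ..., f^(N-1) of some f in
    C' but not in C. In a relation sum_j q_j f^j in C, let j be the first index
    whose coefficients do not all vanish: dividing by f^j, which is possible as C
    is prime, leaves q_j + f r in C, so q_j is in C' because f is, and
    independence modulo C' makes the coefficients of q_j vanish. *)
Lemma has_growth_step C C' k :
  is_prime_ideal C -> is_ideal C' -> ideal_sub C C' -> ~ ideal_sub C' C ->
  has_growth C' k -> has_growth C k.+1.
Proof.
move=> [idC _ prC] idC' CC' nC'C [D growC'].
have [f C'f nCf] : exists2 f, C' f & ~ C f.
  apply: NNPP => nof; apply: nC'C => f C'f; apply: NNPP => nCf.
  by apply: nof; exists f.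
exists (D + msize f)%N => N N_gt0.
have [T [F [cardT sizeF indF]]] := growC' N N_gt0.
exists (T * 'I_N)%type, (fun p : T * 'I_N => F p.1 * f ^+ p.2).
split=> [|[i j]|c Cc].
- by rewrite card_prod cardT card_ord expnSr.
- rewrite (leq_trans (msizeMX _ _ _)) // mulnDl leq_add ?sizeF //=.
  by rewrite mulnC leq_mul2l ltnW ?orbT.
pose q (j : 'I_N) := \sum_i c (i, j) *: F i.
have Cq : C (\sum_j q j * f ^+ j).
  rewrite (_ : \sum_j _ = \sum_p c p *: (F p.1 * f ^+ p.2)) //.
  under eq_bigr do rewrite mulr_suml.
  rewrite exchange_big pair_bigA /=; apply: eq_bigr => -[i j] _ /=.
  by rewrite scalerAl.
(* The prime C does not contain f, so powers of f cancel. *)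
have C_pow j g : C (f ^+ j * g) -> C g.
  by elim: j => [|j IHj]; rewrite ?mul1r // exprS -mulrA => /prC[].
suff c0 j : forall (j' : 'I_N), j' = j :> nat -> forall i, c (i, j') = 0.
  by case=> i j; apply: (c0 j).
elim/ltn_ind: j => j IHj j' Ej; subst j.
have q0 (l : 'I_N) : (l < j')%N -> q l = 0.
  by move=> lt_l; rewrite /q big1 // => i _; rewrite (IHj l) // scale0r.
apply: indF; rewrite -/(q j').
pose r := \sum_(l < N | l != j')
  (if (l < j')%N then 0 else q l * f ^+ (l - j'.+1)).
have : C (f ^+ j' * (q j' + f * r)).
  rewrite (_ : _ * _ = \sum_j q j * f ^+ j) // (bigD1 j') //=.
  rewrite mulrDr mulrC; congr (_ + _).
  rewrite mulrA -exprSr /r mulr_sumr; apply: eq_bigr => l ne_lj.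
  case: ltnP => [/q0->|le_jl]; first by rewrite mulr0 mul0r.
  rewrite mulrCA -exprD subnKC // ltn_neqAle le_jl andbT.
  by rewrite eq_sym; apply: contra ne_lj => /eqP/val_inj->.
move/C_pow/CC' => C'qr; have [_ _ C'M] := idC'.
rewrite -[q j'](addrK (f * r)); apply: idealB => //.
by rewrite mulrC; apply: C'M.
Qed.

(** Polynomials of degree below D N span a space of dimension at most (D N)^m,
    which is less than N^k when k > m and N > D^m. *)
Lemma has_growth_le P k : is_ideal P -> has_growth P k -> (k <= m)%N.
Proof.
move=> [P0 _ _] [D growP]; rewrite leqNgt; apply/negP => lt_mk.
pose N := (D ^ m).+1; have [T [F [cardT sizeF indF]]] := growP N isT.
pose M := (D * N)%N.
have lt_exp (b : 'X_{1..m < M}) i : ((b : 'X_{1..m}) i < M)%N.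
  apply: leq_trans (bmdeg b); rewrite ltnS mdegE (bigD1 i) //=; exact: leq_addr.
pose box (b : 'X_{1..m < M}) := [ffun i => Ordinal (lt_exp b i)].
have box_inj : injective box.
  move=> b b' /ffunP Eb; apply/val_inj/mnmP => i.
  by have := congr1 val (Eb i); rewrite !ffunE.
have : (#|{: 'X_{1..m < M}}| < #|T|)%N.
  apply: leq_ltn_trans (leq_card box box_inj) _.
  rewrite card_ffun !card_ord cardT (@leq_trans (N ^ m.+1)) ?leq_pexp2l //.
  by rewrite expnMn expnS ltn_pmul2r ?expn_gt0.
pose A := \matrix_(i < #|T|, j < #|{: 'X_{1..m < M}}|)
  (F (enum_val i))@_(enum_val j : 'X_{1..m < M}).
(* The coefficient matrix A has more rows than columns, so its rows are
   dependent, which is a vanishing combination of the family. *)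
move=> lt_card; have : kermx A != 0.
  rewrite -mxrank_eq0 mxrank_ker subn_eq0 -ltnNge.
  exact: leq_ltn_trans (rank_leq_col A) lt_card.
case/rowV0Pn=> v /sub_kermxP vA0 /eqP nz_v; apply: nz_v.
pose c i := v 0 (enum_rank i).
suff c0 : \sum_i c i *: F i = 0.
  apply/rowP => i; rewrite mxE -[i]enum_valK; apply: (indF c).
  by rewrite c0.
apply/mpolyP => a; rewrite raddf_sum mcoeff0 /=.
have [lt_aM|le_Ma] := ltnP (mdeg a) M; last first.
  apply: big1 => i _; rewrite mcoeffZ [_@_a]memN_msupp_eq0 ?mulr0 //.
  exact/msize_mdeg_ge/(leq_trans (sizeF i)).
have := congr1 (fun B : 'rV_ _ => B 0 (enum_rank (BMultinom lt_aM))) vA0.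
rewrite !mxE => /(etrans _); apply.
rewrite [RHS](reindex_onto enum_rank enum_val) /=; last first.
  by move=> i _; apply: enum_valK.
apply: eq_big => [i|i _]; first by rewrite enum_rankK eqxx.
by rewrite mcoeffZ mxE !enum_rankK.
Qed.

(** If every leading monomial of I involves a variable in Z, then distinct
    monomials in the variables outside Z are linearly independent modulo I. *)
Lemma has_growth_off I (Z : {set 'I_m}) :
  (forall f a, I f -> is_lex_lead f a -> hits Z a) -> has_growth I #|~: Z|.
Proof.
move=> leadZ; exists m.+1 => N N_gt0.
pose V := {i : 'I_m | i \in ~: Z}.
pose mon (al : {ffun V -> 'I_N}) : 'X_{1..m} :=
  [multinom (if insub i is Some z then (al z : nat) else 0%N) | i < m].
have mon_inj : injective mon.
  move=> al be /mnmP E; apply/ffunP => z; apply: val_inj.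
  by have := E (val z); rewrite !mnmE valK.
exists {ffun V -> 'I_N}, (fun al => 'X_[mon al]); split.
- by rewrite card_ffun card_ord card_sig; congr (_ ^ _)%N; apply: eq_card.
- move=> al; rewrite msizeX mdegE.
  apply: (@leq_trans (\sum_(i < m) N).+1).
    rewrite ltnS; apply: leq_sum => i _; rewrite mnmE.
    by case: insubP => // z _ _; apply: ltnW.
  by rewrite sum_nat_const card_ord mulSn addnC -addn1 leq_add2l.
move=> c Ic al; apply/eqP/negPn/negP => nz_c.
set f := \sum_i _ in Ic.
have coef_f be : f@_(mon be) = c be.
  rewrite /f raddf_sum (bigD1 be) //= mcoeffZ mcoeffX eqxx mulr1.
  rewrite big1 ?addr0 // => ga ne; rewrite mcoeffZ mcoeffX.
  by rewrite (inj_eq mon_inj) (negPf ne) mulr0.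
have [a la] : exists a, is_lex_lead f a.
  apply: lex_lead_exists => f0; case/eqP: nz_c.
  by rewrite -coef_f f0 mcoeff0.
have: hits Z a := leadZ f a Ic la; apply/negP/hitsPn => i Zi.
have [sa _] := la; have [be _ ->] : exists2 be, true & a = mon be.
  apply: NNPP => noa; move: sa; rewrite mcoeff_msupp => /eqP; apply.
  rewrite /f raddf_sum big1 // => be _ /=; rewrite mcoeffZ mcoeffX.
  by case: eqP => [E|]; rewrite ?mulr0 //; case: noa; exists be.
by rewrite mnmE insubF // inE Zi.
Qed.

(** Going down the chain from I, each strict inclusion adds one to the growth
    exponent, which starts at m - |Z| and cannot exceed m. *)
Lemma prime_chain_le I (Z : {set 'I_m}) k :
  (forall f a, I f -> is_lex_lead f a -> hits Z a) ->
  prime_chain I k -> (k <= #|Z|)%N.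
Proof.
move=> leadZ [C [Cpr Clt [CI IC]]].
have growC j : (j <= k)%N -> has_growth (C (k - j)%N) (#|~: Z| + j).
  elim: j => [|j IHj] le_jk.
    rewrite subn0 addn0; apply: has_growth_off => f a Cf; apply: leadZ.
    exact: CI.
  have lt_k : (k - j.+1 < k)%N by rewrite ltn_subrL (leq_ltn_trans _ le_jk).
  have [sC nsC] := Clt _ lt_k; rewrite addnS.
  apply: (has_growth_step _ _ sC nsC); first exact/Cpr/ltnW.
    by case: (Cpr (k - j.+1).+1 lt_k).
  by rewrite subnSK //; apply/IHj/ltnW.
have [idC _ _] := Cpr 0%N isT; have := growC k (leqnn k); rewrite subnn.
move/(has_growth_le idC); rewrite -[X in (_ <= X)%N]card_ord -(cardsC Z).
by rewrite addnC leq_add2r.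
Qed.

Lemma var_ideal_height Z : prime_height (@var_ideal K m Z) #|Z|.
Proof.
split; first exact: var_ideal_chain.
move=> k; apply: prime_chain_le => f a /var_idealP hZ [sa _]; exact: hZ.
Qed.

End Heights.

(** * The toric primes of a partition of the vertices *)

Section MonmapTheory.
Local Open Scope ring_scope.
Variables (K : fieldType) (m N : nat) (u : 'I_m -> 'X_{1..N}).

Lemma monmapD a b : monmap u (a + b) = (monmap u a + monmap u b)%MM.
Proof.
apply/mnmP => k; rewrite mnmDE !mnm_sumE -big_split; apply: eq_bigr => i _ /=.
by rewrite !mulmnE mnmDE mulnDr.
Qed.

Lemma monmapU i : monmap u U_(i)%MM = u i.
Proof.
apply/mnmP => k; rewrite mnm_sumE (bigD1 i) //= mulmnE mnm1E eqxx muln1.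
rewrite big1 ?addn0 // => j ne_ji.
by rewrite mulmnE mnm1E eq_sym (negPf ne_ji) muln0.
Qed.

Lemma monsubXU (Z : {set 'I_m}) i :
  monsub Z u 'X_i = (i \notin Z)%:R *: 'X_[u i] :> {mpoly K[N]}.
Proof. by rewrite monsubX monmapU hitsU. Qed.

End MonmapTheory.

(** The second substitution factors through the first one. *)
Lemma monker_comp (K : fieldType) (m N M : nat) (Z : {set 'I_m})
    (u : 'I_m -> 'X_{1..N}) (u1 : 'I_N -> 'X_{1..M}) (u2 : 'I_m -> 'X_{1..M}) :
  (forall i, u2 i = monmap u1 (u i)) ->
  ideal_sub (@monker K m N Z u) (monker Z u2).
Proof.
move=> u2E f f0; rewrite /monker.
have u2M a : monmap u2 a = monmap u1 (monmap u a).
  apply/mnmP => k; rewrite !mnm_sumE.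
  under eq_bigr do rewrite mulmnE u2E mnm_sumE big_distrl.
  rewrite /= exchange_big /=; apply: eq_bigr => j _.
  rewrite mulmnE mnm_sumE big_distrr; apply: eq_bigr => i _ /=.
  by rewrite !mulmnE mulnA.
transitivity (monsub set0 u1 (monsub Z u f)); last first.
  by rewrite [monsub Z u f]f0 /monsub raddf0.
rewrite [monsub Z u f]comp_mpolyEX [LHS]comp_mpolyEX.
rewrite [RHS]raddf_sum; apply: eq_bigr => a _ /=.
rewrite [RHS]linearZ /= -!/(monsub _ _ _); congr (_ *: _)%R.
rewrite !monsubX [RHS]linearZ /= -/(monsub _ _ _) monsubX u2M.
suff -> : ~~ hits set0 (monmap u a) by rewrite scale1r.
by apply/hitsPn => i; rewrite inE.
Qed.

Section TwoRows.
Variable n : nat.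
Implicit Types (A B : {set 'I_n}) (a b : 'X_{1..n + n}).

Definition xyset A B : {set 'I_(n + n)} :=
  (@lshift n n @: A) :|: (@rshift n n @: B).

Lemma mem_xyset_x A B i : (lshift n i \in xyset A B) = (i \in A).
Proof.
rewrite inE mem_imset; last exact: lshift_inj.
by case: imsetP => [[j _ /eqP]|_]; rewrite ?eq_lrshift ?orbF.
Qed.

Lemma mem_xyset_y A B i : (rshift n i \in xyset A B) = (i \in B).
Proof.
rewrite inE orbC mem_imset; last exact: rshift_inj.
by case: imsetP => [[j _ /eqP]|_]; rewrite ?eq_rlshift ?orbF.
Qed.

Lemma card_xyset A B : #|xyset A B| = #|A| + #|B|.
Proof.
rewrite cardsU !card_imset; [|exact: rshift_inj|exact: lshift_inj].
rewrite -[RHS]subn0; congr (_ - _); apply: eq_card0 => z; rewrite inE.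
apply/negP => /andP[/imsetP[i _ ->] /imsetP[j _ /eqP]].
by rewrite eq_lrshift.
Qed.

Lemma xy_ind (Q : 'I_(n + n) -> Prop) :
  (forall i, Q (lshift n i)) -> (forall i, Q (rshift n i)) -> forall z, Q z.
Proof. by move=> Ql Qr z; case: (split_ordP z) => i ->. Qed.

Lemma xyset_subset A B (Z : {set 'I_(n + n)}) :
  (forall i, i \in A -> lshift n i \in Z) ->
  (forall i, i \in B -> rshift n i \in Z) -> xyset A B \subset Z.
Proof.
move=> AZ BZ; apply/subsetP; apply: xy_ind => i.
  by rewrite mem_xyset_x => /AZ.
by rewrite mem_xyset_y => /BZ.
Qed.

Lemma hits_xysetPn A B a :
  reflect ((forall i, i \in A -> a (lshift n i) = 0) /\
           (forall i, i \in B -> a (rshift n i) = 0)) (~~ hits (xyset A B) a).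
Proof.
apply: (iffP (hitsPn _ _)) => [Z0|[A0 B0]].
  by split=> i i_; apply: Z0; rewrite ?mem_xyset_x ?mem_xyset_y.
by apply: xy_ind => i; rewrite ?mem_xyset_x ?mem_xyset_y; [apply: A0|apply: B0].
Qed.

(** The substitution x_i |-> s_i a_(r i), y_i |-> s_i, where the block of i is
    recorded by r i. The target is the same polynomial ring, with y_i in the role
    of s_i and x_k in that of a_k. *)
Definition toric_exp (r : 'I_n -> 'I_n) (z : 'I_(n + n)) : 'X_{1..n + n} :=
  match split z with
  | inl i => (U_(lshift n (r i)) + U_(rshift n i))%MM
  | inr i => U_(rshift n i)%MM
  end.

Lemma toric_exp_x r i :
  toric_exp r (lshift n i) = (U_(lshift n (r i)) + U_(rshift n i))%MM.
Proof. by rewrite /toric_exp -[lshift n i]/(unsplit (inl i)) unsplitK. Qed.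

Lemma toric_exp_y r i : toric_exp r (rshift n i) = U_(rshift n i)%MM.
Proof. by rewrite /toric_exp -[rshift n i]/(unsplit (inr i)) unsplitK. Qed.

Lemma toric_monmap_y r a i :
  monmap (toric_exp r) a (rshift n i) = a (lshift n i) + a (rshift n i).
Proof.
rewrite mnm_sumE big_split_ord /=; congr (_ + _); rewrite (bigD1 i) //=.
  rewrite toric_exp_x mulmnE mnmDE !mnm1E eqxx eq_lrshift mul1n big1 ?addn0 //.
  move=> j ne; rewrite toric_exp_x mulmnE mnmDE !mnm1E eq_lrshift eq_rshift.
  by rewrite (negPf ne).
rewrite toric_exp_y mulmnE mnm1E eqxx mul1n big1 ?addn0 // => j ne.
by rewrite toric_exp_y mulmnE mnm1E eq_rshift (negPf ne).
Qed.

Lemma toric_monmap_x r a k :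
  monmap (toric_exp r) a (lshift n k) = \sum_(i | r i == k) a (lshift n i).
Proof.
rewrite mnm_sumE big_split_ord /= [X in _ + X]big1 ?addn0; last first.
  by move=> i _; rewrite toric_exp_y mulmnE mnm1E eq_rlshift.
rewrite [RHS]big_mkcond; apply: eq_bigr => i _.
rewrite toric_exp_x mulmnE mnmDE !mnm1E eq_lshift eq_rlshift addn0.
by case: eqP; rewrite ?mul1n ?mul0n.
Qed.

End TwoRows.

Section Toric.
Local Open Scope ring_scope.
Variables (K : fieldType) (n : nat).
Implicit Types (T : {set 'I_n}) (r : 'I_n -> 'I_n) (f : {mpoly K[n + n]}).

Definition minor i j : {mpoly K[n + n]} :=
  xvar K i * yvar K j - xvar K j * yvar K i.

Definition toric T r : {mpoly K[n + n]} -> Prop :=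
  monker (xyset T T) (toric_exp r).

Lemma toric_prime T r : is_prime_ideal (toric T r).
Proof. exact: monker_prime. Qed.

Lemma toric_xvar T r i : toric T r (xvar K i) <-> i \in T.
Proof.
rewrite /toric /monker monsubXU mem_xyset_x; case: (i \in T).
  by rewrite scale0r.
split=> // /eqP; rewrite scale1r => /eqP E.
have := congr1 (mcoeff (toric_exp r (lshift n i))) E.
by rewrite mcoeffX eqxx mcoeff0 => /eqP; rewrite oner_eq0.
Qed.

Lemma toric_yvar T r i : i \in T -> toric T r (yvar K i).
Proof. by move=> iT; rewrite /toric /monker monsubXU mem_xyset_y iT scale0r. Qed.

Lemma toric_minor_cut T r i j : i \in T -> toric T r (minor i j).
Proof.
move=> iT; have [idP _ _] := toric_prime T r; have [_ _ IM] := idP.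
apply: idealB => //; last by apply: IM; apply: toric_yvar.
by rewrite mulrC; apply: IM; apply/toric_xvar.
Qed.

Lemma minorN i j : minor i j = - minor j i.
Proof. by rewrite /minor opprB. Qed.

Lemma toric_minor T r i j : i \notin T -> j \notin T ->
  toric T r (minor i j) <-> r i = r j.
Proof.
move=> iT jT; rewrite /toric /monker /minor /xvar /yvar.
have -> : monsub (xyset T T) (toric_exp r) ('X_(lshift n i) * 'X_(rshift n j)
      - 'X_(lshift n j) * 'X_(rshift n i)) =
    'X_[K, (U_(lshift n (r i)) + (U_(rshift n i) + U_(rshift n j)))]
    - 'X_[(U_(lshift n (r j)) + (U_(rshift n i) + U_(rshift n j)))].
  rewrite {1}/monsub raddfB /= !rmorphM /= -!/(monsub _ _ _).
  rewrite !monsubXU !mem_xyset_x !mem_xyset_y iT jT !scale1r.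
  rewrite !toric_exp_x !toric_exp_y -!mpolyXD.
  by congr ('X_[_] - 'X_[_]); apply/mnmP => k; rewrite !mnmDE; lia.
split=> [/subr0_eq E|->]; last exact: subrr.
have /mem_msuppXP/addIm/mnmP/(_ (lshift n (r i))) :
    (U_(lshift n (r j)) + (U_(rshift n i) + U_(rshift n j)))%MM \in msupp
      'X_[K, (U_(lshift n (r i)) + (U_(rshift n i) + U_(rshift n j)))].
  by rewrite E msuppX mem_head.
by rewrite !mnm1E eqxx eq_lshift; case: eqP => [->|].
Qed.

(** Identifying the parameters a_k and a_(t k) merges blocks. *)
Lemma toric_merge T r t r' : r' =1 t \o r -> ideal_sub (toric T r) (toric T r').
Proof.
move=> r'E.
pose u1 (z : 'I_(n + n)) : 'X_{1..n + n} := match split z with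
  | inl k => U_(lshift n (t k))%MM | inr i => U_(rshift n i)%MM end.
have u1l k : u1 (lshift n k) = U_(lshift n (t k))%MM.
  by rewrite /u1 -[lshift n k]/(unsplit (inl k)) unsplitK.
have u1r k : u1 (rshift n k) = U_(rshift n k)%MM.
  by rewrite /u1 -[rshift n k]/(unsplit (inr k)) unsplitK.
apply: (@monker_comp _ _ _ _ _ _ u1); apply: xy_ind => i.
  by rewrite !toric_exp_x monmapD !monmapU u1l u1r r'E.
by rewrite !toric_exp_y monmapU u1r.
Qed.

Lemma var_ideal_sub_toric T r :
  ideal_sub (@var_ideal K _ (xyset T T)) (toric T r).
Proof.
move=> f /var_idealP hf; have [idP _ _] := toric_prime T r.
rewrite [f]mpoly_sum_termE; apply: ideal_sum => // a /hf.
have [_ _ IM] := idP; move=> ha; apply: IM.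
by rewrite /toric /monker monsubX ha scale0r.
Qed.

End Toric.

(** * Components outside a vertex set and their pivots *)

Section Pivots.
Variables (n : nat) (e : rel 'I_n).
Hypothesis e_sym : symmetric e.
Implicit Types (T A B : {set 'I_n}) (i j k : 'I_n) (w : {ffun 'I_n -> 'I_n}).

(** Vertices of T are isolated for this relation, hence form classes of their
    own; this makes it an equivalence on all vertices. *)
Definition linked T : rel 'I_n := connect (induced e (~: T)).

Lemma linked_sym T : connect_sym (induced e (~: T)).
Proof.
by apply: sym_connect_sym => i j; rewrite /induced /= e_sym andbCA.
Qed.

Lemma linkedC T i j : linked T i j = linked T j i.
Proof. exact: linked_sym. Qed.

Lemma linked_cut T i j : i \in T -> linked T i j -> i = j.
Proof.
move=> iT /connectP[[|k p] /= pth ->] //.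
by move: pth; rewrite /induced /= inE iT.
Qed.

(** A choice v of a vertex in each component, encoded as the retraction sending a
    vertex to the chosen vertex of its class. *)
Definition pivot T w : bool :=
  [forall i, linked T i (w i) && [forall j, linked T i j ==> (w i == w j)]].

Lemma pivotP T w :
  reflect ((forall i, linked T i (w i)) /\
           (forall i j, linked T i j -> w i = w j))
    (pivot T w).
Proof.
apply: (iffP forallP) => [H|[Hi Hij] i].
  split=> [i|i j lij]; have /andP[Li /forallP Lij] := H i; first by [].
  by have := Lij j; rewrite lij => /eqP.
by rewrite Hi; apply/forallP => j; apply/implyP => /Hij->.
Qed.

Lemma pivot_cut T w i : pivot T w -> i \in T -> w i = i.
Proof. by move=> /pivotP[Hi _] iT; apply/esym/(linked_cut iT). Qed.

(** A pivot that depends on T only; it serves as block function for the toric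
    prime of T and as reference for counting components. *)
Definition rep T : {ffun 'I_n -> 'I_n} :=
  [ffun i => fingraph.root (induced e (~: T)) i].

Lemma rep_eq T i j : (rep T i = rep T j) <-> linked T i j.
Proof.
by rewrite !ffunE; split=> /(fingraph.rootP (linked_sym T)).
Qed.

Lemma pivot_rep T : pivot T (rep T).
Proof.
apply/pivotP; split=> [i|i j /rep_eq//].
by rewrite ffunE; apply: connect_root.
Qed.

Lemma rep_idem T i : rep T (rep T i) = rep T i.
Proof. by have /pivotP[Hi _] := pivot_rep T; apply/rep_eq; rewrite linkedC. Qed.

Lemma rep_fix_cut T i : rep T i != i -> (i \notin T) && (rep T i \notin T).
Proof.
move=> ne; apply/andP; split; apply: contra ne => iT.
  by rewrite (pivot_cut (pivot_rep T) iT).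
have /pivotP[Hi _] := pivot_rep T; apply/eqP.
by apply: (linked_cut iT); rewrite linkedC.
Qed.

Lemma card_pivot_fix T w w' : pivot T w -> pivot T w' ->
  #|[set i | w i == i]| = #|[set i | w' i == i]|.
Proof.
have le_fix u u' : pivot T u -> pivot T u' ->
    #|[set i | u i == i]| <= #|[set i | u' i == i]|.
  move=> /pivotP[ul uc] /pivotP[ul' uc'].
  rewrite -(@card_in_imset _ _ u'); last first.
    move=> i j; rewrite !inE => /eqP ui /eqP uj Eij; rewrite -ui -uj; apply: uc.
    by apply: connect_trans (ul' i) _; rewrite Eij -/(linked _ _ _) linkedC.
  apply/subset_leq_card/subsetP => _ /imsetP[i _ ->].
  by rewrite inE eq_sym; apply/eqP/uc'.
by move=> pw pw'; apply/eqP; rewrite eqn_leq !le_fix.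
Qed.

(** This is n + |T| - c(T): the vertices moved by [rep T] are those outside T
    that do not represent their component. *)
Definition cut_height T := #|T| + #|T| + #|[set i | rep T i != i]|.

(** The variables generating P_T(v). *)
Definition pivot_vars T w : {set 'I_(n + n)} :=
  xyset (T :|: [set i : 'I_n | i < w i]) (T :|: [set i : 'I_n | w i < i]).

(** Outside T, a vertex contributes one of its two variables if it is moved by
    the pivot and none if it is fixed. *)
Lemma card_pivot_vars T w : pivot T w -> #|pivot_vars T w| = cut_height T.
Proof.
move=> pw; rewrite card_xyset /cut_height.
have cardUT (A : {set 'I_n}) : (forall i, i \in A -> w i != i) ->
    #|T :|: A| = #|T| + #|A|.
  move=> Aw; rewrite cardsU -[RHS]subn0; congr (_ - _).
  apply: eq_card0 => i; rewrite inE; apply/negP => /andP[iT /Aw].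
  by rewrite (pivot_cut pw iT) eqxx.
rewrite !cardUT; last 2 first.
- by move=> i; rewrite inE; apply: contraTneq => ->; rewrite ltnn.
- by move=> i; rewrite inE; apply: contraTneq => ->; rewrite ltnn.
rewrite addnACA; congr (_ + _).
have moved (u : {ffun 'I_n -> 'I_n}) :
    #|[set i | u i != i]| = n - #|[set i | u i == i]|.
  rewrite cardsCs card_ord; congr (_ - _).
  by apply: eq_card => i; rewrite !inE negbK.
rewrite moved (card_pivot_fix (pivot_rep T) pw) -moved.
rewrite -cardsUI (_ : _ :&: _ = set0) ?cards0 ?addn0; last first.
  by apply/setP => i; rewrite !inE; case: ltngtP.
by apply: eq_card => i; rewrite !inE -val_eqE /= neq_ltn orbC.
Qed.

(** In each class all elements of A are at least all elements of B, so the least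
    element of A, or else the greatest element of B, separates them. *)
Lemma pivot_exists T A B :
  (forall i j, i < j -> linked T i j -> i \in A -> j \notin B) ->
  exists2 w, pivot T w &
    forall i, (i \in A -> w i <= i) /\ (i \in B -> i <= w i).
Proof.
move=> sepAB.
pose good i k := linked T i k && [forall j, linked T i j ==>
  ((j \in A) ==> (k <= j)) && ((j \in B) ==> (j <= k))].
have good_ex i : exists k, good i k.
  have [/existsP[a /andP[ia aA]]|noA] :=
    boolP [exists a, linked T i a && (a \in A)].
    have [|k /andP[ik kA] mink] :=
      @arg_minnP _ a (fun k => linked T i k && (k \in A)) val.
      by rewrite ia.
    exists k; rewrite /good ik; apply/forallP => j; apply/implyP => ij.
    apply/andP; split; apply/implyP => jAB; first by apply: mink; rewrite ij.
    rewrite leqNgt; apply: contraL jAB => lt_kj; apply: (sepAB k) => //.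
    by apply: connect_trans ij; rewrite -/(linked _ _ _) linkedC.
  have notA j : linked T i j -> j \notin A.
    by move=> ij; apply: contra noA => jA; apply/existsP; exists j; rewrite ij.
  have [/existsP[a /andP[ia aB]]|noB] :=
    boolP [exists a, linked T i a && (a \in B)].
    have [|k /andP[ik kB] maxk] :=
      @arg_maxnP _ a (fun k => linked T i k && (k \in B)) val.
      by rewrite ia.
    exists k; rewrite /good ik; apply/forallP => j; apply/implyP => ij.
    by rewrite (negPf (notA j ij)); apply/implyP => jB; apply: maxk; rewrite ij.
  exists i; rewrite /good [linked T i i]connect0.
  apply/forallP => j; apply/implyP => ij.
  rewrite (negPf (notA j ij)); apply/implyP => jB; case/existsP: noB.
  by exists j; rewrite ij.
pose w := [ffun i => odflt i [pick k | good i k]].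
have w_good i : good i (w i).
  by rewrite ffunE; case: pickP => //= nog; have [k] := good_ex i; rewrite nog.
exists w.
  apply/pivotP; split=> [i|i j lij]; first by have /andP[] := w_good i.
  rewrite !ffunE; have Eij : good i =1 good j.
    move=> k; have lE : linked T i =1 linked T j.
      by apply: same_connect lij; apply: linked_sym.
    by rewrite /good lE; congr (_ && _); apply: eq_forallb => l; rewrite lE.
  rewrite -(eq_pick Eij); case: pickP => //= nog.
  by have [k] := good_ex i; rewrite nog.
move=> i; have /andP[_ /forallP/(_ i)] := w_good i.
by rewrite [linked T i i]connect0 => /andP[/implyP ? /implyP ?].
Qed.

End Pivots.

(** * Leading monomials of elements of the toric primes *)

Section LeadingMonomials.
Variables (n : nat) (e : rel 'I_n).
Hypothesis e_sym : symmetric e.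
Implicit Types (T : {set 'I_n}) (i j : 'I_n) (w : {ffun 'I_n -> 'I_n}).
Implicit Types (a b : 'X_{1..n + n}).

(** The image of a monomial records its degree in (x_i, y_i) for each vertex i
    and its total degree in the x_j of each block. If a avoids P_T(v), then in
    each block it has no x_j for j below the pivot and no y_j for j above it: all
    its x-degree is pushed to the largest indices, as far as the fiber allows. *)
Lemma fiber_lex_min T w (r : 'I_n -> 'I_n) a b :
  pivot e T w -> (forall i j, r i = r j -> linked e T i j) ->
  ~~ hits (pivot_vars T w) a ->
  monmap (toric_exp r) b = monmap (toric_exp r) a -> lex_le b a -> b = a.
Proof.
move=> /pivotP[wl wc] rl /hits_xysetPn[xa0 ya0] Eba le_ba; apply: NNPP => ne_ba.
have [z [lt_z eq_z]] := lex_first_diff le_ba ne_ba.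
have degE i : b (lshift n i) + b (rshift n i) = a (lshift n i) + a (rshift n i).
  by rewrite -!(toric_monmap_y r) Eba.
have sumE k :
    \sum_(i | r i == k) b (lshift n i) = \sum_(i | r i == k) a (lshift n i).
  by rewrite -!toric_monmap_x Eba.
(* The first difference cannot be at y_i: x_i agrees, hence so does y_i. *)
elim/xy_ind: z => i in lt_z eq_z *; last first.
  have Ei := eq_z (lshift n i) (ltn_addr _ (ltn_ord i)).
  by have := degE i; rewrite Ei => /addnI E; rewrite E ltnn in lt_z.
have wi : w i <= i.
  rewrite leqNgt; apply/negP => lt_iw.
  by move: lt_z; rewrite [a _]xa0 // !inE lt_iw orbT.
(* In the block of i, the x-exponents of b are at most those of a: they agree
   before i, and after i, hence above the pivot, a has no y. The strict
   inequality at i then contradicts the equality of the sums. *)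
have := sumE (r i); rewrite (bigD1 i) //= [RHS](bigD1 i) //=.
apply/eqP; rewrite neq_ltn; apply/orP; left; rewrite -addSn.
apply: leq_add => //.
apply: leq_sum => j /andP[/eqP rji ne_ji].
have [lt_ji|] := ltnP j i; first by rewrite (eq_z (lshift n j)).
rewrite leq_eqVlt => /orP[/eqP/val_inj E|lt_ij].
  by rewrite E eqxx in ne_ji.
have ya : a (rshift n j) = 0.
  apply: ya0; rewrite !inE (wc j i (rl _ _ rji)).
  by rewrite (leq_ltn_trans wi lt_ij) orbT.
by rewrite -[a (lshift n j)]addn0 -ya -degE leq_addr.
Qed.

Variable K : fieldType.
Local Open Scope ring_scope.

(** By [fiber_lex_min] a leading monomial avoiding P_T(v) would be alone in its
    fiber among the monomials of f, so its coefficient would survive in the image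
    of f. *)
Lemma toric_lead T w (r : 'I_n -> 'I_n) (f : {mpoly K[n + n]}) a :
  pivot e T w -> (forall i j, r i = r j -> linked e T i j) ->
  toric T r f -> is_lex_lead f a -> hits (pivot_vars T w) a.
Proof.
move=> pw rl f0 [sa maxa]; have [//|nh] := boolP (hits (pivot_vars T w) a).
exfalso.
have nhT : ~~ hits (xyset T T) a.
  apply: contra nh => hT; apply: hitsS hT; apply: xyset_subset => i iT.
    by rewrite mem_xyset_x inE iT.
  by rewrite mem_xyset_y inE iT.
have := mcoeff_monsub (xyset T T) (toric_exp r) f (monmap (toric_exp r) a).
rewrite [monsub _ _ f]f0 mcoeff0 big_seq_cond.
rewrite (eq_bigl (fun b => (b \in msupp f) && (b == a))); last first.
  move=> b; have [sb|] //= := boolP (b \in msupp f).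
  have [->|ne_ba] := eqVneq b a; first by rewrite nhT eqxx.
  apply/negP => /andP[_ /eqP Eba]; case/eqP: ne_ba.
  exact: fiber_lex_min pw rl nh Eba (maxa b sb).
rewrite -big_seq_cond -big_filter filter_pred1_uniq ?msupp_uniq // big_seq1.
by move/esym/eqP; apply/negP; rewrite -mcoeff_msupp.
Qed.

End LeadingMonomials.

(** * Reduction modulo the binomial edge ideal *)

Section Reduction.
Local Open Scope ring_scope.
Variables (K : fieldType) (n : nat) (e : rel 'I_n).
Hypothesis e_sym : symmetric e.
Implicit Types (T : {set 'I_n}) (i j k : 'I_n) (w : {ffun 'I_n -> 'I_n}).
Implicit Types (a b c : 'X_{1..n + n}) (f : {mpoly K[n + n]}).
Local Notation J := (binomial_edge_ideal K e).

Lemma edge_ideal_is_ideal : is_ideal J.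
Proof. exact: ideal_gen_ideal. Qed.

Lemma edge_ideal_edge i j : e i j -> J (minor K i j).
Proof.
move=> eij; have [lt_ij|lt_ji|/val_inj E] := ltngtP i j.
- by apply: ideal_gen_mem; exists i, j.
- rewrite minorN; apply: idealN; first exact: edge_ideal_is_ideal.
  by apply: ideal_gen_mem; exists j, i; rewrite e_sym.
by rewrite E /minor subrr; case: edge_ideal_is_ideal.
Qed.

Lemma edge_toric T f : J f -> toric T (rep e T) f.
Proof.
move: f; apply: ideal_gen_min; first by case: (@toric_prime K n T (rep e T)).
move=> _ [i [j [_ eij ->]]]; rewrite -/(minor K i j).
have [iT|iT] := boolP (i \in T); first exact: toric_minor_cut.
have [jT|jT] := boolP (j \in T).
  rewrite minorN; apply: idealN; last exact: toric_minor_cut.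
  by case: (@toric_prime K n T (rep e T)).
apply/toric_minor => //; apply/rep_eq => //; apply: connect1.
by rewrite /induced /= !inE iT jT.
Qed.

(** Induction on the path i, k, ..., j, using the identities
      x_k [i,j] = x_i [k,j] + x_j [i,k],  y_k [i,j] = y_i [k,j] + y_j [i,k]
    between minors: the monomial gives up one variable of the interior vertex k,
    and [i,k] is in the ideal as i, k is an edge. The path has to be simple, since
    each interior vertex is paid for once. *)
Lemma path_minor p i c : path e i p -> uniq (i :: p) ->
  (forall k, k \in p -> k != last i p ->
     0 < c (lshift n k) + c (rshift n k))%N ->
  J ('X_[c] * minor K i (last i p)).
Proof.
have [J0 JD JM] := edge_ideal_is_ideal.
elim: p i c => [|k p IHp] i c /=.
  by rewrite /minor subrr mulr0.
move=> /andP[eik pth] /andP[_ /andP[kp up]] cpos.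
have [Ek|ne_k] := eqVneq k (last k p).
  by rewrite -Ek; apply: JM; apply: edge_ideal_edge.
have step (z : 'I_(n + n)) (g1 g2 : {mpoly K[n + n]}) :
    (0 < c z)%N -> z = lshift n k \/ z = rshift n k ->
    'X_z * minor K i (last k p) = g1 * minor K k (last k p) + g2 * minor K i k ->
    J ('X_[c] * minor K i (last k p)).
  move=> cz zk E; have -> : c = (c - U_(z) + U_(z))%MM.
    by rewrite submK // lep1mP -lt0n.
  rewrite mpolyXD -mulrA E mulrDr; apply: JD; last first.
    by rewrite mulrA; apply: JM; apply: edge_ideal_edge.
  rewrite mulrCA; apply: JM; apply: IHp => //=; first by rewrite kp.
  move=> l lp ne_l; have ne_lk : k != l by apply: contraNneq kp => ->.
  have := cpos l; rewrite inE lp orbT => /(_ isT ne_l).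
  rewrite !mnmBE !mnm1E; case: zk => ->;
    rewrite ?eq_lshift ?eq_rshift ?eq_lrshift ?eq_rlshift (negPf ne_lk) !subn0 //.
have : (0 < c (lshift n k) + c (rshift n k))%N.
  by apply: cpos; rewrite ?mem_head.
rewrite addn_gt0 => /orP[ck|ck].
  apply: (step (lshift n k) (xvar K i) (xvar K (last k p))) => //.
    by left.
  by rewrite /minor -/(xvar K k); ring.
apply: (step (rshift n k) (yvar K i) (yvar K (last k p))) => //; first by right.
by rewrite /minor -/(yvar K k); ring.
Qed.

(** The vertices that do not occur in a; those outside are exactly the ones that
    can serve as interior vertices in [path_minor]. *)
Definition cut_of a : {set 'I_n} :=
  [set i | (a (lshift n i) == 0%N) && (a (rshift n i) == 0%N)].

(** The monomial a x_j y_i / (x_i y_j). *)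
Definition swap a i j : 'X_{1..n + n} :=
  (a - U_(lshift n i) - U_(rshift n j) + U_(lshift n j) + U_(rshift n i))%MM.

Lemma swap_mod a i j : (i < j)%N -> linked e (cut_of a) i j ->
  (0 < a (lshift n i))%N -> (0 < a (rshift n j))%N ->
  J ('X_[a] - 'X_[swap a i j]).
Proof.
move=> lt_ij lij ai aj; pose c := (a - U_(lshift n i) - U_(rshift n j))%MM.
have aE : a = (c + U_(lshift n i) + U_(rshift n j))%MM.
  apply/mnmP; apply: xy_ind => k; rewrite /c !(mnmDE, mnmBE, mnm1E)
    ?eq_lshift ?eq_rshift ?eq_lrshift ?eq_rlshift.
    by case: eqP => [<-|] /=; lia.
  by case: eqP => [<-|] /=; lia.
have -> : 'X_[a] - 'X_[swap a i j] = 'X_[c] * minor K i j.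
  rewrite /swap -/c {1}aE !mpolyXD /minor /xvar /yvar; ring.
have /connectP[p pth Ej] := lij; move: pth Ej.
case/shortenP=> {p} q pth uq _ Ej; rewrite Ej; apply: path_minor => //.
  by apply: sub_path pth => x y /and3P[].
move=> k kq; rewrite -Ej => ne_kj.
have ne_ki : i != k by apply: contraTneq uq => ->; rewrite /= kq.
have : k \in ~: cut_of a.
  have : path (fun _ y => y \in ~: cut_of a) i q.
    by apply: sub_path pth => x y /and3P[].
  elim: (q) (i) kq => // x s IHs y; rewrite inE /=.
  by move=> /predU1P[->|/IHs IH] /andP[] // _ /IH.
rewrite !inE /c !(mnmBE, mnm1E) ?eq_lshift ?eq_rshift ?eq_lrshift ?eq_rlshift.
by rewrite (negPf ne_ki) [j == k]eq_sym (negPf ne_kj); lia.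
Qed.

Lemma swap_lt a i j : (i < j)%N -> (0 < a (lshift n i))%N ->
  lex_le (swap a i j) a /\ swap a i j != a.
Proof.
move=> lt_ij ai; have lt_l : (swap a i j (lshift n i) < a (lshift n i))%N.
  rewrite !(mnmDE, mnmBE, mnm1E) !eq_lshift !eq_rlshift eqxx.
  by rewrite -val_eqE /= gtn_eqF //; lia.
split; last by apply: contraTneq lt_l => ->; rewrite ltnn.
apply: (lex_of_diff lt_l); apply: xy_ind => k /= lt_k; last first.
  by move: lt_k; have := ltn_ord i; lia.
rewrite !(mnmDE, mnmBE, mnm1E) !eq_lshift !eq_rlshift -!val_eqE /=.
by rewrite (gtn_eqF lt_k) (gtn_eqF (ltn_trans lt_k lt_ij)); lia.
Qed.

Definition standard a : Prop :=
  exists T w, pivot e T w /\ ~~ hits (pivot_vars T w) a.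

Lemma standard_or_swap a :
  standard a \/
  (exists i j, [/\ (i < j)%N, linked e (cut_of a) i j,
     (0 < a (lshift n i))%N & (0 < a (rshift n j))%N]).
Proof.
case: (classic (exists i j, [/\ (i < j)%N, linked e (cut_of a) i j,
    (0 < a (lshift n i))%N & (0 < a (rshift n j))%N])) => [|noswap].
  by right.
left; exists (cut_of a).
have [|w pw wP] := @pivot_exists _ e e_sym (cut_of a)
    [set i | 0 < a (lshift n i)]%N [set i | 0 < a (rshift n i)]%N.
  move=> i j lt_ij lij; rewrite !inE => ai; apply/negP => aj.
  by apply: noswap; exists i, j.
exists w; split=> //; apply/hits_xysetPn; split=> i; rewrite !inE.
  case/orP=> [/andP[/eqP->] //|]; have [+ _] := wP i; rewrite inE.
  by case: posnP => // _ /(_ isT); rewrite leqNgt => /negPf->.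
case/orP=> [/andP[_ /eqP->] //|]; have [_ +] := wP i; rewrite inE.
by case: posnP => // _ /(_ isT); rewrite leqNgt => /negPf->.
Qed.

(** Swaps terminate because x_i y_j -> x_j y_i with i < j decreases the sum of
    the indices of the y-variables, counted with multiplicity. *)
Lemma standard_monomial a :
  exists2 b, J ('X_[a] - 'X_[b]) & standard b.
Proof.
have [J0 JD _] := edge_ideal_is_ideal.
have [k] := ubnP (\sum_(i < n) i * a (rshift n i))%N.
elim: k => // k IHk in a *; rewrite ltnS => le_k.
have [std|[i [j [lt_ij lij ai aj]]]] := standard_or_swap a.
  by exists a; rewrite ?subrr.
have [|b Jb std] := IHk (swap a i j); last first.
  exists b => //; rewrite -(subrK 'X_[swap a i j] 'X_[a]) -addrA.
  by apply: JD => //; apply: swap_mod.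
apply: leq_trans le_k; rewrite (bigD1 j) // [X in (_ < X)%N](bigD1 j) //=.
have ne_ij : i != j by rewrite -val_eqE /= ltn_eqF.
rewrite (bigD1 i) // [X in (_ < _ + X)%N](bigD1 i) //= !addnA.
rewrite [X in (_ + X < _)%N](_ : _ =
  \sum_(l < n | (l != j) && (l != i)) l * a (rshift n l))%N.
  rewrite ltn_add2r !(mnmDE, mnmBE, mnm1E) !eq_lrshift !eq_rshift !eqxx.
  by rewrite (negPf ne_ij) [j == i]eq_sym (negPf ne_ij); nia.
apply: eq_bigr => l /andP[lj li].
rewrite !(mnmDE, mnmBE, mnm1E) !eq_lrshift !eq_rshift.
by rewrite ![_ == l]eq_sym (negPf lj) (negPf li); congr (_ * _)%N; lia.
Qed.

End Reduction.

(** * Decompositions of the two ideals *)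

Section Decompositions.
Local Open Scope ring_scope.
Variables (K : fieldType) (n : nat) (e : rel 'I_n).
Hypothesis e_sym : symmetric e.
Implicit Types (T : {set 'I_n}) (i j k : 'I_n) (w : {ffun 'I_n -> 'I_n}).
Implicit Types (a b c : 'X_{1..n + n}) (f g : {mpoly K[n + n]}).
Local Notation J := (binomial_edge_ideal K e).
Local Notation toricG T := (@toric K n T (rep e T)).

Lemma toricG_lead T w f a : pivot e T w -> toricG T f -> is_lex_lead f a ->
  hits (pivot_vars T w) a.
Proof. by move=> pw; apply: toric_lead pw _ => i j /rep_eq; apply. Qed.

(** A chain of full length first kills the variables of T one by one. The last of
    these ideals lies in the toric prime with every vertex in a block of its own;
    from there the vertices that do not represent their component are merged into
    it one by one. *)
Lemma toricG_height T : prime_height (toricG T) (cut_height e T).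
Proof.
split; last first.
  move=> k; rewrite -(card_pivot_vars e_sym (pivot_rep e_sym T)).
  by apply: prime_chain_le => f a; apply: toricG_lead; apply: pivot_rep.
pose M := [set i | rep e T i != i].
pose r (S : {set 'I_n}) i := if i \in S then rep e T i else i.
suff chainS (S : {set 'I_n}) : S \subset M ->
    prime_chain (@toric K n T (r S)) (#|T| + #|T| + #|S|).
  apply: prime_chain_lift (chainS M _) (toric_prime _ _ _) _ => //.
  by apply: (@toric_merge _ _ _ _ id) => i /=; rewrite /r inE; case: eqP.
have [k] := ubnP #|S|; elim: k => // k IHk in S *.
have [->|[s Ss]] := set_0Vmem S => leSk SM.
  rewrite cards0 addn0 -card_xyset.
  apply: prime_chain_lift (var_ideal_chain _ _) (toric_prime _ _ _) _.
  exact: var_ideal_sub_toric.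
rewrite (cardsD1 s S) Ss add1n addnS.
have Ms : s \in M := subsetP SM s Ss.
have /andP[sT rT] : (s \notin T) && (rep e T s \notin T).
  by apply: rep_fix_cut => //; rewrite inE in Ms.
have rep_notM i : rep e T i \notin M by rewrite inE rep_idem // eqxx.
apply: (@prime_chain_step _ (toric T (r (S :\ s)))).
- apply: IHk; first by move: leSk; rewrite (cardsD1 s S) Ss.
  exact: subset_trans (subsetDl _ _) SM.
- exact: toric_prime.
- apply: (@toric_merge _ _ _ _ (fun l => if l == s then rep e T s else l)).
  move=> i; rewrite /= /r !inE; have [->|ne_is] /= := eqVneq i s.
    by rewrite Ss eqxx.
  case: ifP => _; last by rewrite (negPf ne_is).
  by case: eqP => // E; have := rep_notM i; rewrite E Ms.
have nS i : rep e T i \notin S by apply: contra (rep_notM i) => /(subsetP SM).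
have old : toric T (r S) (minor K s (rep e T s)).
  by apply/toric_minor => //; rewrite /r Ss (negPf (nS s)).
move=> /(_ _ old) /(toric_minor _ _ sT rT).
rewrite /r !inE eqxx /= (negPf (nS s)) andbF.
by move=> E; move: Ms; rewrite inE -E eqxx.
Qed.

Lemma standard_form f :
  exists2 g, J (f - g) & forall b, b \in msupp g -> standard e b.
Proof.
have [J0 JD JM] := edge_ideal_is_ideal K e.
rewrite [f]mpoly_sum_termE; elim: (msupp f) => [|a s [g Jg sg]].
  by exists 0 => [|b]; rewrite ?big_nil ?subrr // msupp0.
have [b Jb sb] := standard_monomial K e_sym a.
exists (f@_a *: 'X_[b] + g).
  rewrite big_cons opprD addrACA; apply: JD => //.
  by rewrite -mul_mpolyC -mulrBr; apply: JM.
move=> c /msuppD_le; rewrite mem_cat => /orP[/msuppZ_le|/sg //].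
by rewrite msuppX inE => /eqP->.
Qed.

(** A combination g of standard monomials in the intersection vanishes: its
    leading monomial avoids some P_T(v) with T in the subfamily, whereas g lies
    in the toric prime of T. *)
Lemma toric_cap_sub (D : pred {set 'I_n}) f :
  (forall a, standard e a -> exists T w,
     [/\ D T, pivot e T w & ~~ hits (pivot_vars T w) a]) ->
  (forall T, D T -> toricG T f) -> J f.
Proof.
move=> stdD Df; have [g Jg sg] := standard_form f.
suff g0 : g = 0 by rewrite g0 subr0 in Jg.
apply: NNPP => /lex_lead_exists[a la].
have [sa _] := la; have [T [w [DT pw nh]]] := stdD a (sg a sa).
have tg : toricG T g.
  have [idT _ _] := @toric_prime K n T (rep e T).
  rewrite -[g](subKr f); apply: idealB => //; first exact: Df.
  exact: (edge_toric e_sym _ Jg).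
by rewrite (toricG_lead pw tg la) in nh.
Qed.

Lemma edge_idealE f : J f <-> forall T, toricG T f.
Proof.
split=> [Jf T|tf]; first exact: (edge_toric e_sym _ Jf).
apply: (@toric_cap_sub xpredT) => // a [T [w [pw nh]]].
by exists T, w.
Qed.

Lemma initial_idealE f :
  initial_ideal J f <-> forall T w, pivot e T w -> var_ideal (pivot_vars T w) f.
Proof.
split=> [If T w pw|hf].
  apply: (ideal_gen_min _ _ If).
    by case: (@var_ideal_prime K _ (pivot_vars T w)).
  move=> _ [g [a [Jg la ->]]]; apply/var_idealP => b.
  rewrite msuppX inE => /eqP->.
  by apply: (toricG_lead pw _ la); apply: (edge_toric e_sym _ Jg).
have idI : is_ideal (initial_ideal J) by apply: ideal_gen_ideal.
rewrite [f]mpoly_sum_termE; apply: ideal_sum => // a sa.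
have [_ _ IM] := idI; apply: IM; apply: ideal_gen_mem.
have [[T [w [pw nh]]]|[i [j [lt_ij lij ai aj]]]] := standard_or_swap e_sym a.
  by have /var_idealP/(_ a sa) := hf T w pw; rewrite (negPf nh).
exists ('X_[a] - 'X_[swap a i j]), a; split=> //; first exact: swap_mod.
have [le_sw ne_sw] := swap_lt lt_ij ai; split.
  by rewrite mcoeff_msupp mcoeffB !mcoeffX eqxx (negPf ne_sw) subr0 oner_eq0.
move=> b /msuppB_le; rewrite mem_cat !msuppX !inE => /orP[]/eqP-> //.
exact: lexx.
Qed.

Lemma lead_minor i j : (i < j)%N ->
  is_lex_lead (minor K i j) (U_(lshift n i) + U_(rshift n j))%MM.
Proof.
move=> lt_ij; have ne_ij : i != j by rewrite -val_eqE /= ltn_eqF.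
rewrite /minor /xvar /yvar -!mpolyXD; split.
  rewrite mcoeff_msupp mcoeffB !mcoeffX eqxx.
  case: (_ =P _ :> 'X_{1..n + n}) => [/mnmP/(_ (lshift n i))|_]; last first.
    by rewrite subr0 oner_eq0.
  by rewrite !mnmDE !mnm1E !eq_lshift !eq_rlshift eqxx eq_sym (negPf ne_ij).
move=> b /msuppB_le; rewrite mem_cat !msuppX !inE => /orP[]/eqP->.
  exact: lexx.
apply: (@lex_of_diff _ _ _ (lshift n i)).
  by rewrite !mnmDE !mnm1E !eq_lshift !eq_rlshift eqxx eq_sym (negPf ne_ij).
apply: xy_ind => k /= lt_k; last by have := ltn_ord i; lia.
rewrite !mnmDE !mnm1E !eq_lshift !eq_rlshift -!val_eqE /=.
by rewrite (gtn_eqF lt_k) (gtn_eqF (ltn_trans lt_k lt_ij)).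
Qed.

(** For i < j in one component of G \ T', the minor of i, j is in the toric prime
    of T, so its leading monomial x_i y_j lies in the prime P_T(v), which
    therefore contains x_i or y_j. This is the separation that [pivot_exists]
    turns into a choice v' with P_T'(v') inside P_T(v). *)
Lemma toricG_subset T' T w : pivot e T w -> ideal_sub (toricG T') (toricG T) ->
  exists2 w', pivot e T' w' & pivot_vars T' w' \subset pivot_vars T w.
Proof.
move=> pw sub; have [|w' pw' wP] := @pivot_exists _ e e_sym T'
    [set i | lshift n i \notin pivot_vars T w]
    [set j | rshift n j \notin pivot_vars T w].
  move=> i j lt_ij lij; rewrite inE => iZ; rewrite inE negbK.
  have ijT' : toricG T' (minor K i j).
    have [iT|iT] := boolP (i \in T'); first exact: toric_minor_cut.
    have [jT|jT] := boolP (j \in T').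
      rewrite linkedC // in lij; have E := linked_cut jT lij.
      by rewrite E ltnn in lt_ij.
    by apply/toric_minor => //; apply/rep_eq.
  have := toricG_lead pw (sub _ ijT') (lead_minor lt_ij).
  case/existsP=> z /andP[zZ]; rewrite mnmDE !mnm1E addn_gt0 !lt0b.
  by case/orP=> /eqP E; [rewrite E zZ in iZ | rewrite E].
have T'T : {subset T' <= T}.
  by move=> i /(toric_xvar K T' (rep e T') _)/sub/toric_xvar.
exists w' => //; apply: xyset_subset => i /setUP[/T'T iT|lt_w].
- by rewrite mem_xyset_x inE iT.
- have [+ _] := wP i; rewrite inE in lt_w; rewrite inE => wi.
  apply: contraTT lt_w => /wi.
  by rewrite -leqNgt.
- by rewrite mem_xyset_y inE iT.
have [_ +] := wP i; rewrite inE in lt_w; rewrite inE => wi.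
apply: contraTT lt_w => /wi.
by rewrite -leqNgt.
Qed.

Definition toric_min T : Prop := forall T',
  ideal_sub (toricG T') (toricG T) ->
  ideal_sub (toricG T) (toricG T').

Lemma unmixed_edge_idealE :
  unmixed J <-> exists d, forall T, toric_min T -> cut_height e T = d.
Proof.
rewrite (@unmixed_cap _ _ xpredT (fun T => toricG T) (cut_height e)).
- split=> -[d Hd]; exists d => T.
    by move=> mT; exact: (Hd T isT (fun T' _ => mT T')).
  by move=> _ mT; exact: (Hd T (fun T' => mT T' isT)).
- by move=> T _; apply: toric_prime.
- by move=> T _; apply: toricG_height.
by move=> f; rewrite edge_idealE; split=> tf T *; apply: tf.
Qed.

Definition pivot_min T w : Prop := forall T' w', pivot e T' w' ->
  pivot_vars T' w' \subset pivot_vars T w ->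
  pivot_vars T w \subset pivot_vars T' w'.

Lemma unmixed_initial_idealE :
  unmixed (initial_ideal J) <->
  exists d, forall T w, pivot e T w -> pivot_min T w -> cut_height e T = d.
Proof.
pose D (p : {set 'I_n} * {ffun 'I_n -> 'I_n}) := pivot e p.1 p.2.
pose Q (p : {set 'I_n} * {ffun 'I_n -> 'I_n}) :=
  @var_ideal K _ (pivot_vars p.1 p.2).
rewrite (@unmixed_cap _ _ D Q (fun p => cut_height e p.1)).
- split=> -[d Hd]; exists d.
    move=> T w pw mw; apply: (Hd (T, w)) => // -[T' w'] pw' /var_idealS sub.
    by apply/var_idealS/mw.
  move=> [T w] pw mw; apply: (Hd T w pw) => T' w' pw' sub.
  by apply/(@var_idealS K)/(mw (T', w')) => //; apply/var_idealS.
- by move=> p _; apply: var_ideal_prime.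
- move=> [T w] pw; rewrite -(card_pivot_vars e_sym pw).
  exact: var_ideal_height.
move=> f; rewrite initial_idealE; split=> H; first by case=> T w; apply: H.
by move=> T w pw; apply: (H (T, w)).
Qed.

Lemma toric_inj T T' :
  ideal_sub (toricG T) (toricG T') ->
  ideal_sub (toricG T') (toricG T) -> T = T'.
Proof.
move=> s s'; apply/setP => i; apply/idP/idP.
  by move/(toric_xvar K T (rep e T) _)/s/toric_xvar.
by move/(toric_xvar K T' (rep e T') _)/s'/toric_xvar.
Qed.

Lemma exists_toric_min T :
  exists2 T', toric_min T' & ideal_sub (toricG T') (toricG T).
Proof.
have [|||T' [_ sub minT']] := @finite_minimal _ (fun T1 T2 =>
    ideal_sub (toricG T1) (toricG T2)) xpredT T.
- by move=> T1 f.
- by move=> T1 T2 T3 s12 s23 f /s12/s23.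
- by [].
by exists T'; [exact: (fun T1 => minT' T1 isT) | exact: sub].
Qed.

Lemma exists_pivot_min T w : pivot e T w ->
  exists T' w', [/\ pivot e T' w', pivot_min T' w' &
                    pivot_vars T' w' \subset pivot_vars T w].
Proof.
move=> pw; have [||| [T' w'] [/= pw' sub minp]] := @finite_minimal _
    (fun p q : {set 'I_n} * {ffun 'I_n -> 'I_n} =>
       pivot_vars p.1 p.2 \subset pivot_vars q.1 q.2)
    (fun p => pivot e p.1 p.2) (T, w).
- by move=> p; apply: subxx.
- by move=> q p r; apply: subset_trans.
- exact: pw.
by exists T', w'; split=> // T1 w1 pw1; apply: (minp (T1, w1)).
Qed.

(** Otherwise a monomial avoiding some P_T(v) avoids some P_T'(v') with T' <> T,
    so the toric primes of the T' <> T intersect in the edge ideal, and the one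
    of T contains one of them. *)
Lemma toric_min_pivot T : toric_min T ->
  exists2 w, pivot e T w & forall T' w', pivot e T' w' ->
    pivot_vars T' w' \subset pivot_vars T w -> T' = T.
Proof.
move=> minT; apply: NNPP => now.
have [||T' neT' sub] := @prime_contains_cap _ _ (enum (predC1 T))
    (fun T' => toricG T') (toricG T) (toric_prime K T (rep e T)).
- by move=> T' _; case: (@toric_prime K n T' (rep e T')).
- move=> f tf; apply/(edge_toric e_sym)/(@toric_cap_sub (predC1 T)).
    move=> a [T1 [w1 [pw1 nh]]]; have [E|neT1] := eqVneq T1 T; last first.
      by exists T1, w1.
    subst T1; apply: NNPP => no; apply: now; exists w1 => // T' w' pw' sub.
    apply: NNPP => /eqP neT'; apply: no; exists T', w'; split=> //.
    by apply: contra nh; apply: hitsS.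
  by move=> T' DT'; apply: tf; rewrite mem_enum.
have E : T' = T := toric_inj sub (minT T' sub).
by rewrite mem_enum E inE eqxx in neT'.
Qed.

Lemma unmixed_edge_ideal_initial : unmixed J <-> unmixed (initial_ideal J).
Proof.
rewrite unmixed_edge_idealE unmixed_initial_idealE.
split=> -[d Hd]; exists d.
  move=> T w pw mw; have [T' mT' sub] := exists_toric_min T.
  have [w' pw' subw] := toricG_subset pw sub.
  rewrite -(Hd T' mT') -(card_pivot_vars e_sym pw) -(card_pivot_vars e_sym pw').
  by apply/eqP; rewrite eqn_leq !subset_leq_card // mw.
move=> T mT; have [w pw onlyT] := toric_min_pivot mT.
have [T' [w' [pw' mw' sub]]] := exists_pivot_min pw.
by rewrite -(onlyT T' w' pw' sub); apply: Hd mw'.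
Qed.

End Decompositions.

(** * The ideals generated by variables *)

Section PTHeight.
Local Open Scope ring_scope.
Variables (K : fieldType) (n : nat) (e : rel 'I_n).
Hypothesis e_sym : symmetric e.
Variables (T : {set 'I_n}) (v : 'I_(ncomp e T) -> 'I_n).
Hypothesis v_in : forall k, v k \in component e T k.

Lemma components_partition : partition (components e (~: T)) (~: T).
Proof.
apply: equivalence_partitionP => i j k _ _ _; split; first exact: connect0.
by move=> lij; apply: (same_connect (linked_sym e_sym T) lij).
Qed.

Lemma component_in k : component e T k \in components e (~: T).
Proof. exact: enum_valP. Qed.

Lemma component_notin k i : i \in component e T k -> i \notin T.
Proof.
have /and3P[/eqP cov _ _] := components_partition => ik.
rewrite -in_setC -cov; apply/bigcupP.
by exists (component e T k); rewrite ?component_in.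
Qed.

Lemma component_uniq k l i :
  i \in component e T k -> i \in component e T l -> k = l.
Proof.
have /and3P[_ triv _] := components_partition => ik il; apply: enum_val_inj.
rewrite -/(component e T k) -(def_pblock triv (component_in k) ik).
by rewrite (def_pblock triv (component_in l) il).
Qed.

Lemma component_exists i : i \notin T -> exists k, i \in component e T k.
Proof.
have /and3P[/eqP cov _ _] := components_partition.
rewrite -in_setC -cov => /bigcupP[C CC iC].
by exists (enum_rank_in CC C); rewrite /component enum_rankK_in.
Qed.

Lemma component_linked k i j :
  i \in component e T k -> (j \in component e T k) = linked e T i j.
Proof.
move=> ik; have iT := component_notin ik.
have /and3P[_ triv _] := components_partition.
have [jT|jT] := boolP (j \in T).
  transitivity false; first by apply: contraTF jT => /component_notin.
  apply/esym/negP; rewrite linkedC // => /(linked_cut jT) E.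
  by rewrite -E jT in iT.
rewrite -(def_pblock triv (component_in k) ik).
rewrite pblock_equivalence_partition ?inE //.
move=> x y z _ _ _; split; first exact: connect0.
by move=> lij; apply: (same_connect (linked_sym e_sym T) lij).
Qed.

Definition choice_pivot : {ffun 'I_n -> 'I_n} :=
  [ffun i => if [pick k | i \in component e T k] is Some k then v k else i].

Lemma choice_pivotE k i : i \in component e T k -> choice_pivot i = v k.
Proof.
move=> ik; rewrite ffunE; case: pickP => [l il|/(_ k)]; last by rewrite ik.
by rewrite (component_uniq ik il).
Qed.

Lemma choice_pivot_cut i : i \in T -> choice_pivot i = i.
Proof.
move=> iT; rewrite ffunE; case: pickP => // k /component_notin.
by rewrite iT.
Qed.

Lemma pivot_choice : pivot e T choice_pivot.
Proof.
apply/pivotP; split=> [i|i j lij].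
  have [iT|/component_exists[k ik]] := boolP (i \in T).
    by rewrite choice_pivot_cut //; apply: connect0.
  by rewrite (choice_pivotE ik) -(component_linked _ ik).
have [iT|/component_exists[k ik]] := boolP (i \in T).
  by rewrite (linked_cut iT lij).
by rewrite (choice_pivotE ik) (@choice_pivotE k) // (component_linked _ ik).
Qed.

Lemma card_choice_vars : #|pivot_vars T choice_pivot| = (n + #|T| - ncomp e T)%N.
Proof.
rewrite (card_pivot_vars e_sym pivot_choice) /cut_height.
have -> : #|[set i | rep e T i != i]| = (n - #|[set i | rep e T i == i]|)%N.
  rewrite cardsCs card_ord; congr (_ - _)%N.
  by apply: eq_card => i; rewrite !inE negbK.
rewrite (card_pivot_fix e_sym (pivot_rep e_sym T) pivot_choice).
have v_inj : injective v.
  by move=> k l E; apply: (@component_uniq _ _ (v k)); rewrite ?v_in // E v_in.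
have -> : [set i | choice_pivot i == i] = T :|: v @: setT.
  apply/setP => i; rewrite !inE; have [iT|iT] /= := boolP (i \in T).
    by rewrite choice_pivot_cut // eqxx.
  have [k ik] := component_exists iT; rewrite (choice_pivotE ik).
  apply/eqP/imsetP => [<-|[l _ E]]; first by exists k.
  by rewrite E (component_uniq ik (l := l)) // E.
have cardU : #|T :|: v @: setT| = (#|T| + ncomp e T)%N.
  rewrite cardsU card_imset // cardsT card_ord -[RHS]subn0; congr (_ - _)%N.
  apply: eq_card0 => i; rewrite inE; apply/negP => /andP[iT /imsetP[k _ E]].
  by have := component_notin (v_in k); rewrite -E iT.
rewrite cardU; have : (#|T| + ncomp e T <= n)%N.
  by rewrite -cardU -[X in (_ <= X)%N]card_ord max_card.
lia.
Qed.

Lemma PT_var_ideal f : PT K e T v f <-> var_ideal (pivot_vars T choice_pivot) f.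
Proof.
split.
  apply: ideal_gen_min.
    by case: (@var_ideal_prime K _ (pivot_vars T choice_pivot)).
  move=> _ [[i iT [->|->]]|[k [i [ik lt_i ->]]]|[k [i [ik lt_i ->]]]];
    apply/var_idealXU; rewrite ?mem_xyset_x ?mem_xyset_y inE ?iT //.
    by rewrite inE (choice_pivotE ik) lt_i orbT.
  by rewrite inE (choice_pivotE ik) lt_i orbT.
have idPT : is_ideal (PT K e T v) by apply: ideal_gen_ideal.
have [_ _ PM] := idPT; move=> /var_idealP hf; rewrite [f]mpoly_sum_termE.
apply: ideal_sum => // a /hf /existsP[z /andP[zZ az]]; apply: (PM).
have -> : a = (a - U_(z) + U_(z))%MM by rewrite submK // lep1mP -lt0n.
rewrite mpolyXD; apply: PM; apply: ideal_gen_mem.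
have comp_of i : choice_pivot i != i ->
    exists2 k, i \in component e T k & choice_pivot i = v k.
  have [iT|/component_exists[k ik]] := boolP (i \in T).
    by rewrite choice_pivot_cut // eqxx.
  by exists k => //; apply: choice_pivotE.
elim/xy_ind: z => i in zZ az *; move: zZ;
  rewrite ?mem_xyset_x ?mem_xyset_y !inE => /orP[iT|lt_i].
- by apply: Or31; exists i => //; left.
- have [|k ik E] := comp_of i.
    by apply: contraTneq lt_i => ->; rewrite ltnn.
  by apply: Or32; exists k, i; rewrite -E.
- by apply: Or31; exists i => //; right.
have [|k ik E] := comp_of i.
  by apply: contraTneq lt_i => ->; rewrite ltnn.
by apply: Or33; exists k, i; rewrite -E.
Qed.

Lemma PT_height : ideal_height (PT K e T v) (n + #|T| - ncomp e T).
Proof.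
rewrite -card_choice_vars; split.
  exists (var_ideal (pivot_vars T choice_pivot)); split.
  - exact: var_ideal_prime.
  - by move=> f /PT_var_ideal.
  exact: var_ideal_height.
move=> P k prP PTP [_ maxk]; apply: maxk.
apply: prime_chain_lift (var_ideal_chain _ _) prP _ => f /PT_var_ideal.
exact: PTP.
Qed.

End PTHeight.

Theorem lemma3p4 (K : fieldType) (n : nat) (e : rel 'I_n)
    (e_sym : symmetric e) (e_irr : irreflexive e) :
  (forall T : {set 'I_n}, cutset e T ->
     forall v : 'I_(ncomp e T) -> 'I_n,
       (forall k, v k \in component e T k) ->
       ideal_height (PT K e T v) (n + #|T| - ncomp e T)) /\
  (unmixed (binomial_edge_ideal K e) <->
   unmixed (initial_ideal (binomial_edge_ideal K e))).
Proof.
split; last exact: unmixed_edge_ideal_initial.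
by move=> T _ v v_in; apply: PT_height.
Qed.
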